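(* Let $X\subset\mathbb{A}^N$ be a closed subscheme whose ideal is generated by $m$ polynomials, $I_X=(f_1,\ldots,f_m)\subset k[x_1,\ldots,x_N]$. Let $n\in\mathbb{Z}_{\ge0}$, and let $g=n/2$ if $n$ is even and $g=(n+1)/2$ if $n$ is odd. Let $0\le e_1\le e_2\le\cdots\le e_b<g$ be an increasing sequence of integers, and suppose that $b\le m$ and $b\le N$. (a) For $l\in\{n-g,\ldots,n\}$, the set $\pi^n_l(\mathcal{L}_n^{e_1,\ldots,e_b}(X))$ is locally closed (in $\mathcal{L}_l(\mathbb{A}^N)$). (b) For $\gamma\in\pi^n_{n-g}(\mathcal{L}_n^{e_1,\ldots,e_b}(X))$, there exists an open subset $U_{n-g}$ of $\pi^n_{n-g}(\mathcal{L}_n^{e_1,\ldots,e_b}(X))$ containing $\gamma$ such that, if for $i\in\{n-g+1,\ldots,n\}$ we denote by $U_i$ the inverse image of $U_{n-g}$ under the truncation map $\pi^n_i(\mathcal{L}_n^{e_1,\ldots,e_b}(X))\to\pi^n_{n-g}(\mathcal{L}_n^{e_1,\ldots,e_b}(X))$, then for every $l\in\{n-g,\ldots,n-1\}$ the truncation map $U_{l+1}\to U_l$ is a trivial fibration with fibre $\mathbb{A}^{N-a}$, where $a$ is the largest number of $\{0,\ldots,b\}$ satisfying $e_a<n-l$. (c) For $n>l\ge n-g$, the truncation map $$\mathcal{L}_n^{e_1,\ldots,e_b}(X)\to\pi^n_l(\mathcal{L}_n^{e_1,\ldots,e_b}(X))$$ is a locally trivial fibration with fibre an affine space. If $l=n-g$,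 the dimension of this fibre is at least $\lceil (N-b)(n/2)\rceil$, and if moreover $e_1+\cdots+e_b\ge n/2$, then it is at least $\lceil (N-b+1)(n/2)\rceil$. (d) Let $\theta\in\mathcal{L}_n^{e_1,\ldots,e_b}(X)$. Let $M$ be a closed subscheme of $\mathbb{A}^N$ defined by $b$ elements of $I_X$ such that $\theta\in\mathcal{L}_n^{e_1,\ldots,e_b}(M)$. If $\alpha\in\mathcal{L}_n^{e_1,\ldots,e_b}(M)$ satisfies $\pi^n_{n-g}(\alpha)=\pi^n_{n-g}(\theta)$, then $\alpha\in\mathcal{L}_n^{e_1,\ldots,e_b}(X)$.
   Context: $k$ is an algebraically closed field of arbitrary characteristic. For a closed subscheme $X\subset\mathbb{A}^N$ with ideal $I_X$, an $n$-jet on $X$ is a closed point of the jet scheme $\mathcal{L}_n(X)$, i.e. a tuple $\theta\in(k[t]/(t^{n+1}))^N$ with $f(\theta)=0$ for all $f\in I_X$. The set of $n$-jets is denoted $\mathcal{L}_n(X)$; it is a closed subset of $\mathcal{L}_n(\mathbb{A}^N)\cong\mathbb{A}^{N(n+1)}$ (Zariski topology). $\pi^n_l:\mathcal{L}_n(X)\to\mathcal{L}_l(X)$ ($n\ge l$) is the truncation map. Locally closed subsets carry their reduced structure; a map is a trivial fibration with fibre $F$ if it is isomorphic to the projection of a product of the target with $F$, and a locally trivial fibration with fibre $F$ if this holds Zariski-locally on the target. For any closed subscheme $Z\subset\mathbb{A}^N$ with ideal $I_Z=(h_1,\ldots,h_s)$ and $\theta\in\mathcal{L}_n(Z)$, consider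 the quotient of the $k[[t]]$-module $(k[[t]]/(t^{n+1}))^N$ by the submodule generated by the rows of $\bigl(\frac{\partial h_i}{\partial x_j}(\theta)\bigr)_{1\le i\le s,\,1\le j\le N}$. It is isomorphic to $\bigoplus_{i=1}^N k[[t]]/(t^{e_i})$ for a unique sequence of integers $0\le e_1\le\cdots\le e_N\le n+1$; write $e_i=e_i(Z;\theta)$ (independent of the generators chosen for $I_Z$). For a sequence of integers $0\le e_1\le\cdots\le e_b<g$ with $b\le N$, $\mathcal{L}_n^{e_1,\ldots,e_b}(Z)$ is the set of $\theta\in\mathcal{L}_n(Z)$ with $e_i(Z;\theta)=e_i$ for $1\le i\le b$ and, if $b<N$, $e_{b+1}(Z;\theta)\ge g$. Convention: $e_0=0$. *)

(* Defs.v *)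
From mathcomp Require Import all_boot all_order all_algebra.
From mathcomp Require Import qpoly.
From mathcomp Require Import mpoly.

Set Implicit Arguments.
Unset Strict Implicit.
Unset Printing Implicit Defensive.

Import GRing.Theory.
Local Open Scope ring_scope.

(* Classical (reduced) algebraic geometry over an algebraically closed field. *)
(* A point of A^d is a row vector, a subset of A^d is a Prop-valued predicate.*)
Section Zariski.
Variable k : closedFieldType.

Definition zclosed d (C : 'rV[k]_d -> Prop) : Prop :=
  exists F : {mpoly k[d]} -> Prop,
    forall x, C x <-> (forall p, F p -> p.@[x 0] = 0).

Definition zopen d (U : 'rV[k]_d -> Prop) : Prop := zclosed (fun x => ~ U x).

Definition locally_closed d (S : 'rV[k]_d -> Prop) : Prop :=
  exists U C, [/\ zopen U, zclosed C & forall x, S x <-> U x /\ C x].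

Definition open_in d (S V : 'rV[k]_d -> Prop) : Prop :=
  exists2 U, zopen U & forall x, V x <-> S x /\ U x.

(* Morphisms out of a locally closed S with its reduced structure: the        *)
(* coordinates are quotients P / Q of polynomials locally on S.               *)
Definition regular_on d r (S : 'rV[k]_d -> Prop) (phi : 'rV[k]_d -> 'rV[k]_r)
    : Prop :=
  forall x, S x -> forall j, exists P Q : {mpoly k[d]},
    Q.@[x 0] != 0 /\
    (forall y, S y -> Q.@[y 0] != 0 -> phi y 0 j = P.@[y 0] / Q.@[y 0]).

Definition isomorphism d r (S : 'rV[k]_d -> Prop) (T : 'rV[k]_r -> Prop)
    (phi : 'rV[k]_d -> 'rV[k]_r) (psi : 'rV[k]_r -> 'rV[k]_d) : Prop :=
  [/\ regular_on S phi, regular_on T psi,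
      forall x, S x -> T (phi x) /\ psi (phi x) = x
    & forall y, T y -> S (psi y) /\ phi (psi y) = y].

Definition zproduct d r (T : 'rV[k]_d -> Prop) (F : 'rV[k]_r -> Prop)
    : 'rV[k]_(d + r) -> Prop :=
  fun z => T (lsubmx z) /\ F (rsubmx z).

Definition affine_space d : 'rV[k]_d -> Prop := fun=> True.

(* [h] restricts to a map S -> T (this is a consequence) that is isomorphic   *)
(* to the first projection T x F -> T.                                        *)
Definition trivial_fibration d r q (S : 'rV[k]_d -> Prop)
    (T : 'rV[k]_r -> Prop) (h : 'rV[k]_d -> 'rV[k]_r)
    (F : 'rV[k]_q -> Prop) : Prop :=
  exists phi psi, isomorphism S (zproduct T F) phi psi /\
    (forall x, S x -> lsubmx (phi x) = h x).

Definition locally_trivial_fibration d r q (S : 'rV[k]_d -> Prop)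
    (T : 'rV[k]_r -> Prop) (h : 'rV[k]_d -> 'rV[k]_r)
    (F : 'rV[k]_q -> Prop) : Prop :=
  (forall x, S x -> T (h x)) /\
  (forall y, T y -> exists V, [/\ open_in T V, V y
     & trivial_fibration (fun x => S x /\ V (h x)) V h F]).

End Zariski.

Arguments affine_space : clear implicits.

(* V / S and W / T are isomorphic, for submodules S of V and T of W: f is a   *)
(* set-theoretic lift V -> W of an isomorphism V / S -> W / T.                *)
Definition quotient_isom (R : nzRingType) (V W : lmodType R)
    (S : V -> Prop) (T : W -> Prop) : Prop :=
  exists f : V -> W,
    [/\ forall a u v, T (f (a *: u + v) - (a *: f u + f v)),
        forall v, T (f v) <-> S v
      & forall w, exists v, T (w - f v)].

Section Jets.
Variable k : closedFieldType.

(* k[t]/(t^(n+1)) = k[[t]]/(t^(n+1)); t is the class 'qX. *)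
Definition trunc_ring (n : nat) := {poly %/ ('X^(n.+1) : {poly k})}.

Definition row_submodule (R : comNzRingType) s N (J : 'M[R]_(s, N))
    : 'rV[R]_N -> Prop :=
  fun v => exists c : 'rV[R]_s, v = c *m J.

(* With A = k[t]/(t^(n+1)) and all e_j <= n+1, A^N modulo this submodule is   *)
(* the direct sum of the k[[t]]/(t^(e_j)).                                    *)
Definition torsion_submodule n N (e : N.-tuple nat)
    : 'rV[trunc_ring n]_N -> Prop :=
  fun w => forall j, exists a : trunc_ring n,
    w 0 j = a * ('qX : trunc_ring n) ^+ tnth e j.

(* The elements of (k[t]/(t^(n+1)))^N are identified with the points of       *)
(* A^(N(n+1)) through their N x (n+1) matrix of coefficients.                 *)
Definition jet_series n N (x : 'rV[k]_(N * n.+1)) : 'rV[trunc_ring n]_N :=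
  \row_i in_qpoly 'X^(n.+1) (rVpoly (row i (vec_mx x))).

Definition jet_coord n N (theta : 'rV[trunc_ring n]_N) : 'rV[k]_(N * n.+1) :=
  mxvec (\matrix_i (poly_rV (theta 0 i : {poly k}) : 'rV[k]_(n.+1))).

Definition jet_trunc N n l (x : 'rV[k]_(N * n.+1)) : 'rV[k]_(N * l.+1) :=
  jet_coord
    (map_mx (fun a : trunc_ring n => in_qpoly 'X^(l.+1) (a : {poly k}))
      (jet_series x)).

Definition jet_eval n N (p : {mpoly k[N]}) (x : 'rV[k]_(N * n.+1))
    : trunc_ring n :=
  mmap (in_alg (trunc_ring n)) (jet_series x 0) p.

(* The closed subschemes of A^N are given by generators h of their ideal. *)
Definition in_ideal N s (h : s.-tuple {mpoly k[N]}) (p : {mpoly k[N]}) : Prop :=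
  exists c : 'I_s -> {mpoly k[N]}, p = \sum_i c i * tnth h i.

Definition jets n N s (h : s.-tuple {mpoly k[N]})
    : 'rV[k]_(N * n.+1) -> Prop :=
  fun x => forall p, in_ideal h p -> jet_eval p x = 0.

Definition jet_jacobian n N s (h : s.-tuple {mpoly k[N]})
    (x : 'rV[k]_(N * n.+1)) : 'M[trunc_ring n]_(s, N) :=
  \matrix_(i, j) jet_eval ((tnth h i)^`M(j)) x.

(* E is the sequence e_1(Z; x) <= ... <= e_N(Z; x). All the k[[t]]-modules    *)
(* involved are killed by t^(n+1), so that k[[t]]-linear maps between them    *)
(* are the same as k[t]/(t^(n+1))-linear maps.                                *)
Definition jet_invariants n N s (h : s.-tuple {mpoly k[N]})
    (x : 'rV[k]_(N * n.+1)) (E : N.-tuple nat) : Prop :=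
  [/\ sorted leq E, all (fun a => a <= n.+1)%N E
    & quotient_isom (row_submodule (jet_jacobian h x))
                    (@torsion_submodule n N E)].

(* L_n^(e_1, ..., e_b)(Z), with respect to the bound g; [nth] counts from 0. *)
Definition jet_stratum n g N s b (h : s.-tuple {mpoly k[N]})
    (e : b.-tuple nat) : 'rV[k]_(N * n.+1) -> Prop :=
  fun x => jets h x /\ exists E : N.-tuple nat,
    [/\ jet_invariants h x E,
        forall i, (i < b)%N -> nth 0%N E i = nth 0%N e i
      & (b < N)%N -> (g <= nth 0%N E b)%N].

Definition trunc_image N n l (S : 'rV[k]_(N * n.+1) -> Prop)
    : 'rV[k]_(N * l.+1) -> Prop :=
  fun y => exists2 x, S x & y = jet_trunc l x.

End Jets.

(* Main.v *)
Require Import Defs.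
From mathcomp Require Import all_boot all_order all_algebra.
From mathcomp Require Import perm qpoly.
From mathcomp Require Import mpoly.
From mathcomp Require Import zify.
From HB Require Import structures.
From Stdlib Require Import Classical.

Set Implicit Arguments.
Unset Strict Implicit.
Unset Printing Implicit Defensive.

Import GRing.Theory.
Local Open Scope ring_scope.

(** Write [R = k[t]/(t^(n+1))] and [l0 = n - g]. The choice of [g] makes
    [2 (l0 + 1) > n], so that [t^(l0+1) R] has square zero. Hence first-order
    Taylor expansion is exact when a jet is changed above level [l0]: among the
    jets with a given truncation to level [l0], the equations of [X] form a
    system of affine linear equations over [k] for the higher coefficients,
    [x *m jet_mx x = jet_rhs x], whose matrix is built from the Jacobian matrix
    of the generators at the truncation ([jets_linear]).

    The matrix of this system, restricted to the unknowns of level above [c], is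
    multiplication by [t^(c+1)] followed by the transposed Jacobian matrix. Its
    rank over [k] is read off from elementary divisors: it is the sum of the
    truncated differences [n - c - e_i]. For [l0 <= c <= n] only the
    invariants [e_i < g] contribute, and conversely these ranks determine
    them. Thus the stratum is the set of solutions of the linear system at
    which all these ranks have prescribed values ([jet_stratumP]), and this
    rank condition depends only on the truncation to level [l0]. Elementary
    divisors exist because [R] is a local principal ideal ring ([smith_form]),
    and they are unique because they are counted by the dimensions of
    [t^j M / t^(j+1) M] ([count_exponents_le]).

    (a) A jet of level [l] lifts to the stratum iff the system for the remaining
    unknowns is solvable, which again is a rank condition ([trunc_imageP]); lower
    bounds for ranks are open conditions, and upper bounds are closed.

    (b), (c) Near a given point choose pivot unknowns such that, for every [c],
    the pivots above level [c] index a basis of the rows above level [c]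
    ([level_pivots]). As the ranks are constant, the same pivots serve on the
    open set where one determinant does not vanish. There Cramer's rule gives the
    pivot coefficients of a solution as regular functions of the free ones, and
    the compatibility with levels ensures that the part of a solution up to
    level [c] only involves free coefficients up to level [c]. So truncation is
    the projection that forgets free coefficients ([chart_fibration]), and
    counting them gives the dimensions of the fibres.

    (d) The difference of the two jets solves the homogeneous system of [M]. The
    kernel of the system of [X] is contained in that of [M], and both have the
    same dimension, so they agree ([jet_stratum_sub_ideal]). *)

(** * Coordinate masks and pivots adapted to levels *)

Section CoordinateMasks.
Variable F : fieldType.
Implicit Types p q : nat.

Definition maskmx p (B : {set 'I_p}) : 'M[F]_p :=
  diag_mx (\row_i (i \in B)%:R).

Lemma mul_maskmxE p q (B : {set 'I_p}) (A : 'M[F]_(p, q)) i j :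
  (maskmx B *m A) i j = if i \in B then A i j else 0.
Proof. by rewrite mul_diag_mx !mxE; case: ifP; rewrite ?mul1r ?mul0r. Qed.

Lemma mulmx_maskE p q (B : {set 'I_q}) (A : 'M[F]_(p, q)) i j :
  (A *m maskmx B) i j = if j \in B then A i j else 0.
Proof. by rewrite mul_mx_diag !mxE; case: ifP; rewrite ?mulr1 ?mulr0. Qed.

Lemma maskmxE p (B : {set 'I_p}) i j :
  maskmx B i j = ((i == j) && (j \in B))%:R.
Proof.
by rewrite -[maskmx B]mul1mx mulmx_maskE !mxE andbC; case: ifP.
Qed.

Lemma maskmxM p (B C : {set 'I_p}) : maskmx B *m maskmx C = maskmx (B :&: C).
Proof.
apply/matrixP => i j; rewrite mul_maskmxE !maskmxE inE.
have [->|_] := eqVneq i j; first by case: (j \in B).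
by case: (i \in B).
Qed.

Lemma maskmxD p (B : {set 'I_p}) : maskmx B + maskmx (~: B) = 1%:M.
Proof.
apply/matrixP => i j; rewrite [LHS]mxE !maskmxE inE [RHS]mxE.
by case: eqP; case: (j \in B); rewrite /= ?addr0 ?add0r.
Qed.

Lemma mask_subset p q (B C : {set 'I_p}) (A : 'M[F]_(p, q)) :
  B \subset C -> (maskmx B *m A <= maskmx C *m A)%MS.
Proof. by move=> /setIidPl <-; rewrite -maskmxM -mulmxA submxMl. Qed.

Lemma maskmxU p (B C : {set 'I_p}) : [disjoint B & C] ->
  maskmx (B :|: C) = maskmx B + maskmx C.
Proof.
rewrite -setI_eq0 => /eqP/setP dBC; apply/matrixP => i j; rewrite [RHS]mxE !maskmxE.
have := dBC j; rewrite !inE.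
by case: eqP; case: (j \in B); case: (j \in C); rewrite /= ?addr0 ?add0r.
Qed.

Lemma row_mask1 p q (i : 'I_p) (A : 'M[F]_(p, q)) :
  (maskmx [set i] *m A :=: row i A)%MS.
Proof.
apply/eqmxP/andP; split.
  apply/row_subP => j; have [->|/negPf ji] := eqVneq j i.
    rewrite (_ : row i (_ *m _) = row i A) //.
    by apply/rowP => l; rewrite [LHS]mxE mul_maskmxE inE eqxx [RHS]mxE.
  rewrite (_ : row j _ = 0) ?sub0mx //.
  by apply/rowP => l; rewrite [LHS]mxE mul_maskmxE inE ji mxE.
rewrite (_ : row i A = row i (maskmx [set i] *m A)) ?row_sub //.
by apply/rowP => j; rewrite [LHS]mxE [RHS]mxE mul_maskmxE inE eqxx.
Qed.

Lemma rank_mask_le p q (B : {set 'I_p}) (A : 'M[F]_(p, q)) :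
  (\rank (maskmx B *m A) <= #|B|)%N.
Proof.
have [n] := ubnP #|B|; elim: n B => // n IH B Bn.
have [->|/set0Pn[i iB]] := eqVneq B set0.
  rewrite (_ : _ *m _ = 0) ?mxrank0 //.
  by apply/matrixP => i j; rewrite mul_maskmxE inE mxE.
have cB := cardsD1 i B; rewrite iB in cB.
rewrite -[in maskmx B](setD1K iB) maskmxU; last first.
  by rewrite -setI_eq0 setIDA setIC -setIDA setDv setI0.
rewrite mulmxDl (leq_trans (mxrank_add _ _)) // cB leq_add //; last first.
  by apply: IH; rewrite cB in Bn.
by rewrite row_mask1 rank_leq_row.
Qed.

Lemma rank_maskmx p (B : {set 'I_p}) : \rank (maskmx B) = #|B|.
Proof.
apply/eqP; rewrite eqn_leq -{1}[maskmx B]mulmx1 rank_mask_le /=.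
have := mxrank_add (maskmx B) (maskmx (~: B)); rewrite maskmxD mxrank1.
have := rank_mask_le (~: B) 1%:M; rewrite mulmx1.
move=> h1 h2; rewrite -(leq_add2r #|~: B|) cardsC card_ord (leq_trans h2) //.
by rewrite leq_add2l.
Qed.

Definition row_indep p q (A : 'M[F]_(p, q)) (B : {set 'I_p}) :=
  \rank (maskmx B *m A) == #|B|.

Lemma row_indep_sub p q (A : 'M[F]_(p, q)) (B C : {set 'I_p}) :
  B \subset C -> row_indep A C -> row_indep A B.
Proof.
move=> BC /eqP rC; rewrite /row_indep eqn_leq rank_mask_le /=.
have eC : C = B :|: (C :\: B) by rewrite -{1}(setID C B) (setIidPr BC).
have dB : [disjoint B & C :\: B].
  by rewrite -setI_eq0 setIDA setIC -setIDA setDv setI0.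
have h : (\rank (maskmx C *m A) <=
          \rank (maskmx B *m A) + \rank (maskmx (C :\: B) *m A))%N.
  by rewrite [in maskmx C]eC maskmxU // mulmxDl mxrank_add.
rewrite -(leq_add2r #|C :\: B|).
have -> : (#|B| + #|C :\: B| = #|C|)%N.
  by rewrite -(cardsID B C) (setIidPr BC).
rewrite -rC (leq_trans h) // leq_add2l rank_mask_le //.
Qed.

(** Steinitz: a maximal independent set of rows between [B] and [C] already spans
    all rows in [C]. *)
Lemma row_indep_extend p q (A : 'M[F]_(p, q)) (B C : {set 'I_p}) :
  B \subset C -> row_indep A B ->
  exists B' : {set 'I_p}, [/\ B \subset B', B' \subset C, row_indep A B'
               & (maskmx C *m A <= maskmx B' *m A)%MS].
Proof.
move=> BC iB; pose P := [pred X : {set 'I_p} | (X \subset C) && row_indep A X].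
have [|B' maxB' BB'] := @maxset_exists _ P B; first by rewrite /= BC.
have /andP[B'C iB'] := maxsetp maxB'; exists B'; split=> //.
apply/row_subP => i; rewrite row_mul rowE.
have [iC|niC] := boolP (i \in C); last first.
  rewrite (_ : _ *m maskmx C = 0) ?mul0mx ?sub0mx //.
  apply/rowP => j; rewrite mulmx_maskE !mxE eqxx /=; case: ifP => // jC.
  by case: eqP niC => // <-; rewrite jC.
rewrite (_ : _ *m maskmx C = delta_mx 0 i); last first.
  apply/rowP => j; rewrite mulmx_maskE !mxE eqxx /=.
  by case: (eqVneq j i) => [->|]; rewrite ?iC ?if_same.
rewrite -rowE; have [iB0|niB'] := boolP (i \in B').
  by rewrite -row_mask1 mask_subset // sub1set.
have sBi : B' \subset i |: B' by rewrite subsetUr.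
have nind : ~~ row_indep A (i |: B').
  apply/negP => ind; have := maxsetsup maxB' _ sBi.
  rewrite /= subUset sub1set iC B'C ind => /(_ isT) e.
  by move: niB'; rewrite -e setU11.
have rk : \rank (maskmx (i |: B') *m A) = \rank (maskmx B' *m A).
  apply/eqP; rewrite eq_sym eqn_leq mxrankS ?mask_subset //=.
  rewrite (eqP iB') -ltnS.
  have := rank_mask_le (i |: B') A; rewrite leq_eqVlt cardsU1 niB' => /orP[e|//].
  by case/negP: nind; rewrite /row_indep cardsU1 niB'.
have := mxrank_leqif_eq (mask_subset A sBi); rewrite rk => -[_].
rewrite eqxx => /esym/andP[_]; apply: submx_trans.
by rewrite -row_mask1 mask_subset // sub1set setU11.
Qed.

(** Pivots compatible with a filtration of the rows: a basis of the rows of high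
    level is extended downwards, one level at a time. A row added while passing
    to a lower level cannot itself be of higher level, since the rows of higher
    level are already spanned. *)
Lemma level_pivots p q (A : 'M[F]_(p, q)) (lev : 'I_p -> nat) l0 n :
  (forall i, lev i <= n)%N ->
  exists P : {set 'I_p},
    [/\ forall i, i \in P -> (l0 < lev i)%N,
        row_indep A P
      & forall c, (l0 <= c)%N ->
        \rank (maskmx [set i | c < lev i]%N *m A)
          = #|[set i in P | c < lev i]%N| ].
Proof.
move=> levn; pose D c := [set i | c < lev i]%N.
have [ll|nl] := leqP l0 n; last first.
  exists set0; split; first by move=> i; rewrite inE.
    by rewrite /row_indep eqn_leq rank_mask_le cards0.
  move=> c lc; have D0 : D c = set0.
    apply/setP => i; rewrite !inE; apply/negbTE; rewrite -leqNgt.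
    by rewrite (leq_trans (levn i)) // ltnW // (leq_trans nl).
  rewrite -/(D c) D0 (_ : [set i in set0 | _] = set0) ?cards0.
    by apply/eqP; rewrite -leqn0 (leq_trans (rank_mask_le _ _)) ?cards0.
  by apply/setP => i; rewrite !inE.
suff H d : (d <= n - l0)%N -> exists P : {set 'I_p}, [/\ P \subset D (n - d)%N,
    row_indep A P
    & forall c, (n - d <= c)%N ->
        \rank (maskmx (D c) *m A) = #|P :&: D c| ].
  have [P [PD iP rP]] := H _ (leqnn _); rewrite subKn // in PD rP.
  exists P; split=> // [i /(subsetP PD)|c /rP->]; first by rewrite inE.
  by congr #|pred_of_set _|; apply/setP => i; rewrite !inE.
elim: d => [_|d IH dl].
  exists set0; split; first exact: sub0set.
    by rewrite /row_indep eqn_leq rank_mask_le cards0.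
  rewrite subn0 => c nc; have -> : D c = set0.
    by apply/setP => i; rewrite !inE; apply/negbTE; rewrite -leqNgt (leq_trans _ nc).
  rewrite setI0 cards0.
  by apply/eqP; rewrite -leqn0 (leq_trans (rank_mask_le _ _)) ?cards0.
have [P [PD iP rP]] := IH (ltnW dl).
have DD c c' : (c <= c')%N -> D c' \subset D c.
  by move=> cc; apply/subsetP => i; rewrite !inE; apply: leq_ltn_trans.
have ndd : (n - d.+1 <= n - d)%N by rewrite leq_sub2l.
have [P' [PP' P'D iP' sP']] := row_indep_extend (subset_trans PD (DD _ _ ndd)) iP.
exists P'; split=> // c; rewrite leq_eqVlt => /orP[/eqP <-|].
  rewrite (setIidPl P'D) -(eqP iP'); apply/eqP.
  by rewrite eqn_leq; apply/andP; split; rewrite mxrankS // mask_subset.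
have -> : (n - d.+1 < c)%N = (n - d <= c)%N.
  by rewrite -subSn ?subSS // (leq_trans dl) ?leq_subr.
move=> dc; rewrite rP //.
have e : P = P' :&: D (n - d)%N.
  apply/eqP; rewrite eqEcard subsetI PP' PD /= -[in leqRHS](setIidPl PD) -rP //.
  have /eqP <- := row_indep_sub (subsetIl P' (D (n - d)%N)) iP'.
  by rewrite mxrankS // mask_subset // subsetIr.
by rewrite e -setIA (setIidPr (DD _ _ dc)).
Qed.

End CoordinateMasks.

(** * Linear systems whose unknowns carry levels *)

Section LevelSystem.
Variables (F : fieldType) (p q : nat) (lev : 'I_p -> nat) (l0 : nat).
Implicit Types (A : 'M[F]_(p, q)) (w : 'rV[F]_q) (P : {set 'I_p}).
Implicit Types (C : 'M[F]_(q, p)) (x y z : 'rV[F]_p).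

(** The pivot rows of [A], completed to a square matrix by the identity on the
    free coordinates. Testing the independence of the pivot rows against a
    fixed [C] turns it into the non-vanishing of one determinant, without
    choosing columns. *)
Definition pivot_mx P C A : 'M[F]_p :=
  maskmx F P *m A *m C + maskmx F (~: P).

(** Cramer's rule: keep the free coordinates of [z] and compute the pivot
    coordinates that a solution of [x *m A = w] with these free coordinates
    must have. *)
Definition solve_pivots P C A w z : 'rV[F]_p :=
  z *m maskmx F (~: P)
  + (w - z *m maskmx F (~: P) *m A) *m C *m invmx (pivot_mx P C A)
    *m maskmx F P.

Lemma solve_pivots_free P C A w z :
  solve_pivots P C A w z *m maskmx F (~: P) = z *m maskmx F (~: P).
Proof.
rewrite mulmxDl -!mulmxA !maskmxM setIid setICr.
by rewrite (_ : maskmx F set0 = 0) ?mulmx0 ?addr0 //;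
   apply/matrixP => i j; rewrite maskmxE inE andbF mxE.
Qed.

Lemma solve_pivots_eq P C A w x y :
  x *m maskmx F (~: P) = y *m maskmx F (~: P) ->
  solve_pivots P C A w x = solve_pivots P C A w y.
Proof. by rewrite /solve_pivots => ->. Qed.

Lemma solve_pivotsK P C A w x : pivot_mx P C A \in unitmx ->
  x *m A = w -> solve_pivots P C A w x = x.
Proof.
move=> uK xA; rewrite /solve_pivots -xA -mulmxBl -[X in X - _]mulmx1.
rewrite -(maskmxD _ P) -mulmxBr addrK.
have -> : x *m maskmx F P *m A *m C = x *m maskmx F P *m pivot_mx P C A.
  rewrite mulmxDr -!mulmxA (mulmxA (maskmx F P) (maskmx F P)) !maskmxM setIid.
  rewrite setICr (_ : maskmx F set0 = 0) ?mulmx0 ?addr0 //.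
  by apply/matrixP => i j; rewrite maskmxE inE andbF mxE.
rewrite mulmxK // -mulmxA maskmxM setIid -mulmxDr addrC.
by rewrite maskmxD mulmx1.
Qed.

(** Take for [C] a right inverse of the independent rows. *)
Lemma pivot_mx_exists P A : row_indep A P -> exists C, pivot_mx P C A = 1%:M.
Proof.
move=> /eqP iP; set B := maskmx F P *m A.
have tP : (maskmx F P)^T = maskmx F P by rewrite /maskmx tr_diag_mx.
have BP : (B^T <= maskmx F P)%MS by rewrite trmx_mul tP submxMl.
have := mxrank_leqif_eq BP; rewrite mxrank_tr iP rank_maskmx => -[_].
rewrite eqxx => /esym/andP[_ /submxP[X eX]]; exists X^T.
rewrite /pivot_mx -/B -[B]trmxK -trmx_mul -eX tP; exact: maskmxD.
Qed.

Lemma pivot_mx_indep P C A (B : {set 'I_p}) :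
  pivot_mx P C A \in unitmx -> B \subset P -> row_indep A B.
Proof.
move=> uK BP; rewrite /row_indep eqn_leq rank_mask_le /=.
have e : maskmx F B *m pivot_mx P C A = maskmx F B *m A *m C.
  rewrite mulmxDr !mulmxA !maskmxM (setIidPl BP).
  rewrite (_ : maskmx F (B :&: ~: P) = 0) ?addr0 //.
  apply/matrixP => i j; rewrite maskmxE !inE mxE.
  by case jB: (j \in B); rewrite ?(subsetP BP _ jB) /= andbF.
rewrite -(rank_maskmx F B) -[leqLHS](mxrankMfree _ (_ : row_free (pivot_mx P C A))).
  by rewrite e mxrankM_maxl.
by rewrite row_free_unit.
Qed.

Section OneSystem.
Variables (A : 'M[F]_(p, q)) (w : 'rV[F]_q) (P : {set 'I_p}) (C : 'M[F]_(q, p)).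
Hypothesis uK : pivot_mx P C A \in unitmx.
Hypothesis rank_level : forall c, (l0 <= c)%N ->
  \rank (maskmx F [set i | c < lev i]%N *m A) = #|[set i in P | c < lev i]%N|.

Lemma pivots_span c : (l0 <= c)%N ->
  (maskmx F [set i | c < lev i]%N *m A
     <= maskmx F [set i in P | c < lev i]%N *m A)%MS.
Proof.
move=> lc; have sub : [set i in P | c < lev i]%N \subset [set i | c < lev i]%N.
  by apply/subsetP => i; rewrite !inE => /andP[].
have := mxrank_leqif_eq (mask_subset A sub); rewrite rank_level //.
have subP : [set i in P | c < lev i]%N \subset P.
  by apply/subsetP => i; rewrite !inE => /andP[].
by rewrite (eqP (pivot_mx_indep uK subP)) => -[_]; rewrite eqxx => /esym/andP[].
Qed.

(** Changing free coordinates of level above [c] disturbs the equations by a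
    combination of rows of level above [c]; as the pivots above [c] span those
    rows, adjusting them is enough to solve the equations again. *)
Lemma solve_pivots_level c x z : (l0 <= c)%N -> x *m A = w ->
  (forall i, (lev i <= c)%N -> z 0 i = x 0 i) ->
  let y := solve_pivots P C A w z in
  y *m A = w /\ forall i, (lev i <= c)%N -> y 0 i = x 0 i.
Proof.
move=> lc xA zx; set D := [set i in P | c < lev i]%N.
set F' := maskmx F (~: P); set v := (z - x) *m F'.
have vc : v = v *m maskmx F [set i | c < lev i]%N.
  apply/rowP => i; rewrite mulmx_maskE inE; case: ltnP => // ic.
  rewrite mulmx_maskE; case: ifP => // _.
  by rewrite [LHS]mxE [X in _ + X]mxE zx // subrr.
have : (v *m A <= maskmx F D *m A)%MS.
  by rewrite vc -mulmxA (submx_trans (submxMl _ _)) // pivots_span.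
case/submxP => d ed; pose y := x + v - d *m maskmx F D.
have yA : y *m A = w.
  by rewrite mulmxBl mulmxDl xA ed mulmxA addrK.
have yF : y *m F' = z *m F'.
  have DF : maskmx F D *m F' = 0.
    rewrite maskmxM; apply/matrixP => i j; rewrite maskmxE !inE mxE.
    by case: (j \in P); rewrite /= ?andbF.
  have FF : F' *m F' = F' by rewrite maskmxM setIid.
  by rewrite mulmxBl mulmxDl /v -!mulmxA DF FF mulmx0 subr0 mulmxBl addrC subrK.
rewrite /= -(solve_pivots_eq C A w yF) solve_pivotsK //; split=> // i ic.
rewrite /y vc [LHS]mxE [X in X + _]mxE [X in _ + X]mxE !mulmx_maskE !inE.
rewrite ltnNge ic andbF.
by rewrite addr0 subr0.
Qed.

(** Give [x] the free coordinates of [y] above level [c] and solve for the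
    pivots: the result agrees with [x] up to level [c], and it is [y] because
    it has the same free coordinates. *)
Lemma solution_eq_level c x y : (l0 <= c)%N -> x *m A = w -> y *m A = w ->
  (forall i, (lev i <= c)%N -> i \notin P -> x 0 i = y 0 i) ->
  forall i, (lev i <= c)%N -> x 0 i = y 0 i.
Proof.
move=> lc xA yA xy; pose z := \row_i if (lev i <= c)%N then x 0 i else y 0 i.
have zx i : (lev i <= c)%N -> z 0 i = x 0 i by move=> ic; rewrite mxE ic.
have [_ e] := solve_pivots_level lc xA zx => i ic; rewrite -e //.
suff zy : z *m maskmx F (~: P) = y *m maskmx F (~: P).
  by rewrite (solve_pivots_eq C A w zy) solve_pivotsK.
apply/rowP => j; rewrite !mulmx_maskE inE; case: ifP => // jP.
by rewrite mxE; case: ifP => // jc; rewrite xy.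
Qed.

End OneSystem.
End LevelSystem.

(** * Elementary divisors over truncated power series *)

Section TruncatedSeries.
Import Pdiv.CommonRing Pdiv.RingMonic.
Variables (k : closedFieldType) (n : nat).
Local Notation R := (trunc_ring k n).
Implicit Types (a b : R) (p : {poly k}).

Lemma mk_monic_trunc : mk_monic 'X^(n.+1) = 'X^(n.+1) :> {poly k}.
Proof. by rewrite mk_monic_Xn. Qed.

Lemma size_trunc a : (size (a : {poly k}) <= n.+1)%N.
Proof.
by rewrite (leq_trans (size_npoly a)) // mk_monic_trunc size_polyXn.
Qed.

Lemma coef_trunc_big a s : (n < s)%N -> (a : {poly k})`_s = 0.
Proof. by move=> ns; rewrite nth_default // (leq_trans (size_trunc a)). Qed.

Lemma coef_in_trunc p s :
  (in_qpoly 'X^(n.+1) p : {poly k})`_s = if (s <= n)%N then p`_s else 0.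
Proof.
rewrite /= mk_monic_trunc -{1}(poly_take_drop n.+1 p) addrC.
rewrite rmodp_addl_mul_small ?monicXn ?coef_take_poly //.
by rewrite size_polyXn ltnS size_take_poly.
Qed.

Lemma truncP a b :
  (forall s, (s <= n)%N -> (a : {poly k})`_s = (b : {poly k})`_s) -> a = b.
Proof.
move=> ab; apply/val_inj/polyP => s; have [/ab//|ns] := leqP s n.
by rewrite !coef_trunc_big.
Qed.

Lemma in_trunc_val a : in_qpoly 'X^(n.+1) (a : {poly k}) = a.
Proof. by apply: truncP => s sn; rewrite coef_in_trunc sn. Qed.

Lemma coef_truncM a b s : (s <= n)%N ->
  (a * b : {poly k})`_s
    = \sum_(i < s.+1) (a : {poly k})`_i * (b : {poly k})`_(s - i).
Proof.
move=> sn; rewrite -[a * b]in_trunc_val.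
rewrite -[in a * b](in_trunc_val a) -[in _ * b](in_trunc_val b).
by rewrite -in_qpolyM in_trunc_val coef_in_trunc sn coefM.
Qed.

Lemma coef_truncXM a e s :
  ('qX ^+ e * a : {poly k})`_s
    = if (e <= s <= n)%N then (a : {poly k})`_(s - e) else 0.
Proof.
rewrite -[in LHS](in_trunc_val a) /qpolyX -rmorphXn -in_qpolyM coef_in_trunc.
by rewrite coefXnM ltnNge; case: (s <= n)%N; case: (e <= s)%N.
Qed.

Lemma truncX0 e : (n < e)%N -> 'qX ^+ e = 0 :> R.
Proof.
move=> ne; apply: truncP => s sn; rewrite -['qX ^+ e]mulr1 coef_truncXM.
by rewrite leqNgt (leq_ltn_trans sn ne) coef0.
Qed.

Definition trunc_shift e a : R := in_qpoly 'X^(n.+1) (drop_poly e (a : {poly k})).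

Lemma coef_trunc_shift e a s : (trunc_shift e a : {poly k})`_s = (a : {poly k})`_(s + e).
Proof.
rewrite coef_in_trunc coef_drop_poly; case: leqP => // ns.
by rewrite coef_trunc_big // ltn_addr.
Qed.

Lemma trunc_shiftK e a : (forall s, (s < e)%N -> (a : {poly k})`_s = 0) ->
  a = 'qX ^+ e * trunc_shift e a.
Proof.
move=> ae; apply: truncP => s sn; rewrite coef_truncXM coef_trunc_shift sn andbT.
by case: leqP => [es|/ae//]; rewrite subnK.
Qed.

(** The constant coefficient is nonzero iff the polynomial is coprime to
    [t^(n+1)]. *)
Lemma trunc_unit a : (a : {poly k})`_0 != 0 -> exists b, b * a = 1.
Proof.
move=> a0; exists (qpoly_inv a); apply: qpoly_mulVz.
have cop p : p`_0 != 0 -> coprimep 'X^(n.+1) p.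
  move=> p0; rewrite coprimep_expl // coprimep_sym -['X]subr0 -[0]/(0%:P).
  by rewrite coprimep_XsubC rootE horner_coef0.
suff H d : d = 'X^(n.+1) -> coprimep d (a : {poly k}) by exact: H mk_monic_trunc.
by move=> ->; exact: cop.
Qed.

Lemma truncX_dvd e e' a : (e <= n.+1)%N -> 'qX ^+ e' = 'qX ^+ e * a -> (e <= e')%N.
Proof.
move=> en ee; rewrite leqNgt; apply/negP => lt.
have e'n : (e' <= n)%N by rewrite -ltnS (leq_trans lt).
have := congr1 (fun x : R => (x : {poly k})`_e') ee.
rewrite coef_truncXM leqNgt lt -['qX ^+ e']mulr1 coef_truncXM leqnn e'n subnn.
by rewrite coef1 => /eqP; rewrite oner_eq0.
Qed.

Lemma low_mulmxl e (m q l : nat) (A : 'M[R]_(m, q)) (B : 'M[R]_(q, l)) :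
    (e <= n)%N ->
    (forall i j s, (s < e)%N -> (A i j : {poly k})`_s = 0) ->
  forall i j s, (s < e)%N -> ((A *m B) i j : {poly k})`_s = 0.
Proof.
move=> en Al i j s se; rewrite mxE coefn_sum big1 // => a _.
rewrite coef_truncM ?(leq_trans (ltnW se)) // big1 // => b _.
by rewrite Al ?mul0r // (leq_trans (ltn_ord b)).
Qed.

Lemma low_mulmxr e (m q l : nat) (A : 'M[R]_(m, q)) (B : 'M[R]_(q, l)) :
    (e <= n)%N ->
    (forall i j s, (s < e)%N -> (B i j : {poly k})`_s = 0) ->
  forall i j s, (s < e)%N -> ((A *m B) i j : {poly k})`_s = 0.
Proof.
move=> en Bl i j s se; rewrite -[A *m B]trmxK trmx_mul mxE.
by apply: low_mulmxl se => // i' j' s' ?; rewrite mxE Bl.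
Qed.

Lemma mulmx_cancel2 (S : pzRingType) (m q r : nat) (A : 'M[S]_(m, q)) A' (B : 'M_(q, r)) B' :
  A *m A' = 1%:M -> B *m B' = 1%:M -> A *m B *m (B' *m A') = 1%:M.
Proof. by move=> AA' BB'; rewrite mulmxA -(mulmxA A) BB' mulmx1. Qed.

Definition elementary_mx N (E : N.-tuple nat) : 'M[R]_N :=
  diag_mx (\row_j 'qX ^+ tnth E j).

(** An entry of least order of vanishing divides all the others, so that one row
    and one column can be split off. Only the row space of [J] matters: instead
    of an invertible matrix on the left, [J] and [diag(t^E) *m Q] are required
    to divide each other on the left, which avoids completing a rectangular
    matrix to the right shape. *)
Lemma smith_form m N (J : 'M[R]_(m, N)) :
  exists (E : N.-tuple nat) (Q Q' : 'M[R]_N) G H,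
    [/\ sorted leq E /\ all (fun e => e <= n.+1)%N E,
        Q *m Q' = 1%:M, Q' *m Q = 1%:M,
        J = G *m elementary_mx E *m Q & elementary_mx E *m Q = H *m J].
Proof.
elim: N J => [|N IH] J.
  by exists [tuple], 1%:M, 1%:M, 0, 0; split=> //; apply/matrixP => i [].
pose nz s := [exists i, exists j, (J i j : {poly k})`_s != 0].
have [ex|nex] := boolP [exists s : 'I_n.+1, nz s]; last first.
  have J0 : J = 0.
    apply/matrixP => i j; rewrite mxE; apply: truncP => s sn; rewrite coef0.
    apply/eqP; apply: contraNT nex => Js.
    apply/existsP; exists (Ordinal (sn : s < n.+1)%N).
    by apply/existsP; exists i; apply/existsP; exists j.
  have D0 : elementary_mx (nseq_tuple N.+1 n.+1) = 0.
    apply/matrixP => i j; rewrite !mxE.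
    rewrite (tnth_nth 0%N) (_ : nth _ _ _ = n.+1) ?truncX0 ?mul0rn //.
    by have := nth_nseq 0%N N.+1 n.+1 i; rewrite ltn_ord.
  exists (nseq_tuple N.+1 n.+1), 1%:M, 1%:M, 0, 0.
  rewrite D0 J0 !mulmx1 !mulmx0; split=> //.
  split; last by rewrite /= leqnn /= all_nseq leqnn orbT.
  by rewrite /=; elim: (N) => //= N' ->; rewrite leqnn.
have exs : exists s, nz s by case/existsP: ex => s; exists s.
have [e0 nze0 min_e0] := ex_minnP exs.
have /existsP[i0 /existsP[j0 Je0]] := nze0.
have Jlow i j s : (s < e0)%N -> (J i j : {poly k})`_s = 0.
  move=> se; apply/eqP; apply: contraTT se => Js; rewrite -leqNgt min_e0 //.
  by apply/existsP; exists i; apply/existsP; exists j.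
have e0n : (e0 <= n)%N.
  by rewrite leqNgt; apply: contra Je0 => ?; rewrite coef_trunc_big.
pose t : R := 'qX ^+ e0.
(* W has the row of least order, divided by t^e0, as its first row, so that
   J T W^-1 has the row (t^e0, 0) at index i0. *)
have [|u' uu'] := trunc_unit (a := trunc_shift e0 (J i0 j0)).
  by rewrite coef_trunc_shift add0n.
pose r := \row_j trunc_shift e0 (J i0 (tperm 0 j0 j)).
pose T : 'M[R]_(1 + N) := tperm_mx 0 j0.
have TT : T *m T = 1%:M by rewrite -perm_mxM tperm2 perm_mx1.
pose u : R := r 0 0; pose r' : 'rV[R]_N := rsubmx (r : 'rV_(1 + N)).
have uu : u' * u = 1 by rewrite /u mxE tpermL.
have uu2 : u * u' = 1 by rewrite mulrC.
pose W : 'M[R]_(1 + N) := block_mx u%:M r' 0 1%:M.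
pose W' : 'M[R]_(1 + N) := block_mx u'%:M (- u' *: r') 0 1%:M.
have WW' : W *m W' = 1%:M.
  rewrite mulmx_block !mulmx0 !mul0mx !mulmx1 !addr0 !add0r -scalar_mxM.
  rewrite uu2 mul_scalar_mx scalerA mulrN uu2 scaleN1r addNr.
  by rewrite -scalar_mx_block.
have W'W : W' *m W = 1%:M.
  rewrite mulmx_block !mulmx0 !mul0mx !mulmx1 !addr0 !add0r -scalar_mxM.
  by rewrite uu mul_scalar_mx scaleNr addrN -scalar_mx_block.
pose J' : 'M[R]_(m, 1 + N) := J *m T *m W'.
have rowJ' : row i0 J' = row_mx t%:M 0.
  have -> : row i0 J' = t *: (r : 'rV_(1 + N)) *m W'.
    rewrite /J' row_mul; congr (_ *m _); apply/rowP => j.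
    by rewrite -xcolE !mxE -trunc_shiftK // => s; exact: Jlow.
  have -> : (r : 'rV_(1 + N)) = row_mx u%:M r'.
    rewrite -[LHS](@hsubmxK _ 1 1 N); congr row_mx.
    by apply/rowP => j; rewrite !ord1 mxE lshift0 [RHS]mxE.
  rewrite -scalemxAl mul_row_block !mulmx0 addr0 mulmx1 -scalar_mxM uu2.
  rewrite mul_scalar_mx scalerA mulrN uu2 scaleN1r addNr scale_row_mx.
  by rewrite scaler0 scale_scalar_mx mulr1.
have J'low i j s : (s < e0)%N -> (J' i j : {poly k})`_s = 0.
  by move: i j s; do 2!apply: low_mulmxl => //.
have eJ : J = J' *m (W *m T).
  by rewrite /J' -!mulmxA (mulmxA W') W'W mul1mx TT mulmx1.
pose c : 'cV[R]_m := \col_i trunc_shift e0 (J' i 0).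
pose J1 : 'M[R]_(m, N) := rsubmx J'.
have eJ' : J' = row_mx (t *: c) J1.
  rewrite -[LHS]hsubmxK; congr row_mx; apply/matrixP => i j.
  rewrite !ord1 [LHS]mxE lshift0 [RHS]mxE [c _ _]mxE -trunc_shiftK //.
  exact: J'low.
have [E1 [Q1 [Q1' [G1 [H1 [[sE1 aE1] QQ1 QQ1' JG JH]]]]]] := IH J1.
have e0E1 j : (e0 <= tnth E1 j)%N.
  have low_t : (forall s, (s < e0)%N -> (('qX ^+ tnth E1 j : R) : {poly k})`_s = 0).
    have -> : 'qX ^+ tnth E1 j = (H1 *m J1 *m Q1') j j.
      by rewrite -JH -mulmxA QQ1 mulmx1 !mxE eqxx mulr1n.
    apply: low_mulmxl => //; apply: low_mulmxr => // i' j' s se.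
    by rewrite mxE J'low.
  by apply: truncX_dvd (trunc_shiftK low_t); rewrite (leq_trans e0n).
pose E := [tuple of e0 :: E1].
have DE : elementary_mx E = block_mx t%:M 0 0 (elementary_mx E1) :> 'M[R]_(1 + N).
  rewrite -[LHS](@submxK _ 1 N 1 N); congr block_mx; apply/matrixP => i j; rewrite !mxE.
  - by rewrite !ord1 lshift0 tnth0.
  - by rewrite !ord1 lshift0.
  - by rewrite !ord1 lshift0.
  - by rewrite -(inj_eq (@rshift_inj 1 N)) !rshift1 tnthS.
pose B : 'M[R]_(1 + N) := block_mx 1%:M 0 0 Q1.
pose B' : 'M[R]_(1 + N) := block_mx 1%:M 0 0 Q1'.
(* The correction by row i0 clears the first column. *)
pose H2 : 'M[R]_(1 + N, m) :=
  col_mx (delta_mx 0 i0) (H1 - (H1 *m c) *m delta_mx 0 i0).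
have BB' : B *m B' = 1%:M.
  rewrite mulmx_block !mulmx0 !mul0mx mulmx1 !addr0 add0r QQ1.
  by rewrite -scalar_mx_block.
have B'B : B' *m B = 1%:M.
  rewrite mulmx_block !mulmx0 !mul0mx mulmx1 !addr0 add0r QQ1'.
  by rewrite -scalar_mx_block.
have eDB : (elementary_mx E : 'M[R]_(1 + N)) *m B
    = block_mx t%:M 0 0 (elementary_mx E1 *m Q1) :> 'M[R]_(1 + N).
  by rewrite DE mulmx_block !mulmx0 !mul0mx mulmx1 !addr0 add0r.
have eG : row_mx c G1 *m ((elementary_mx E : 'M[R]_(1 + N)) *m B) = J'.
  by rewrite eDB eJ' mul_row_block !mulmx0 addr0 add0r mulmxA -JG mul_mx_scalar.
have eH : (elementary_mx E : 'M[R]_(1 + N)) *m B = H2 *m J'.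
  rewrite eDB /H2 mul_col_mx mulmxBl -[H1 *m c *m _ *m J']mulmxA -!rowE rowJ'.
  rewrite eJ' !mul_mx_row mulmx0 opp_row_mx oppr0 add_row_mx addr0 -JH.
  by rewrite mul_mx_scalar -scalemxAr subrr.
clearbody B B' c J1 J' W W' T t.
exists E, (B *m (W *m T)), (T *m W' *m B'), (row_mx c G1), H2.
split.
- split; last by rewrite /= (leq_trans e0n).
  rewrite /= path_min_sorted //; apply/allP => x /tnthP[j ->]; exact: e0E1.
- exact: mulmx_cancel2 BB' (mulmx_cancel2 WW' TT).
- exact: mulmx_cancel2 (mulmx_cancel2 TT W'W) B'B.
- by rewrite eJ -eG -!mulmxA.
- by rewrite eJ !mulmxA -eH.
Qed.

End TruncatedSeries.

(** * Uniqueness of the invariants *)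

Lemma card_tnth N (E : N.-tuple nat) (P : pred nat) :
  #|[set i | P (tnth E i)]| = count P E.
Proof. by rewrite -sum1_count big_tuple sum1dep_card. Qed.

(** The terms below [j] are the first ones. *)
Lemma sorted_nth_lt s i j : sorted leq s -> (i < size s)%N ->
  (nth 0%N s i < j)%N = (i < count (fun x => x < j)%N s)%N.
Proof.
elim: s i => //= x s IH i sxs; have ss := path_sorted sxs.
have [xj|jx] := ltnP x j.
  by case: i => [|i] //= si; rewrite IH // add1n ltnS.
have /allP xs : all (leq x) s by apply: order_path_min sxs; exact: leq_trans.
have -> : count (fun y => y < j)%N s = 0%N.
  apply/eqP; rewrite eqn0Ngt -has_count; apply/hasPn => y /xs xy.
  by rewrite -leqNgt (leq_trans jx).
case: i => [|i] /=; first by rewrite [LHS]ltnNge jx.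
rewrite ltnS => si; apply/negbTE; rewrite -leqNgt (leq_trans jx) // xs //.
exact: mem_nth.
Qed.

Section Invariants.
Variables (k : closedFieldType) (n : nat).
Local Notation R := (trunc_ring k n).

Lemma torsion_rowsP N (E : N.-tuple nat) (v : 'rV[R]_N) :
  torsion_submodule E v <-> exists c, v = c *m elementary_mx k n E.
Proof.
split=> [tv|[c ->] j]; last by exists (c 0 j); rewrite mul_mx_diag !mxE.
have [c cv] := fin_all_exists tv.
by exists (\row_j c j); apply/rowP => j; rewrite mul_mx_diag !mxE cv.
Qed.

Lemma torsionD N (E : N.-tuple nat) (u v : 'rV[R]_N) :
  torsion_submodule E u -> torsion_submodule E v -> torsion_submodule E (u + v).
Proof.
rewrite !torsion_rowsP => -[c ->] [d ->].
by exists (c + d); rewrite mulmxDl.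
Qed.

Lemma torsionZ N (E : N.-tuple nat) (a : R) (u : 'rV[R]_N) :
  torsion_submodule E u -> torsion_submodule E (a *: u).
Proof.
by rewrite !torsion_rowsP => -[c ->]; exists (a *: c); rewrite scalemxAl.
Qed.

Lemma torsionN N (E : N.-tuple nat) (u : 'rV[R]_N) :
  torsion_submodule E u -> torsion_submodule E (- u).
Proof. by rewrite -scaleN1r; exact: torsionZ. Qed.

Lemma torsionB N (E : N.-tuple nat) (u v : 'rV[R]_N) :
  torsion_submodule E u -> torsion_submodule E v -> torsion_submodule E (u - v).
Proof. by move=> tu /torsionN; exact: torsionD. Qed.

Lemma torsion0 N (E : N.-tuple nat) : torsion_submodule E (0 : 'rV[R]_N).
Proof. by rewrite torsion_rowsP; exists 0; rewrite mul0mx. Qed.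

Lemma torsion_sum N (E : N.-tuple nat) I (r : seq I) (F : I -> 'rV[R]_N) :
  (forall i, torsion_submodule E (F i)) ->
  torsion_submodule E (\sum_(i <- r) F i).
Proof.
by move=> tF; elim/big_ind: _ => //; [exact: torsion0 | exact: torsionD].
Qed.

(** Because the source is free, the given set-theoretic lift can be replaced by
    the linear map with the same values on the basis. *)
Lemma quotient_isom_mx N (S : 'rV[R]_N -> Prop) (E : N.-tuple nat) :
    S 0 -> quotient_isom S (@torsion_submodule k n N E) ->
  exists F : 'M[R]_N, (forall v, S v <-> torsion_submodule E (v *m F)) /\
    (forall w, exists v, torsion_submodule E (w - v *m F)).
Proof.
move=> S0 [f [flin fS fsurj]]; pose T := @torsion_submodule k n N E.
exists (\matrix_i f (delta_mx 0 i)); set F := \matrix_i _.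
have fsum (I : eqType) (r : seq I) (a : I -> R) (u : I -> 'rV[R]_N) :
    T (f (\sum_(i <- r) a i *: u i) - \sum_(i <- r) a i *: f (u i)).
  elim: r => [|i r IH]; first by rewrite !big_nil subr0 /T fS.
  rewrite !big_cons.
  have := torsionD (flin (a i) (u i) (\sum_(j <- r) a j *: u j)) IH.
  by rewrite !opprD !addrA subrK.
have fF v : T (f v - v *m F).
  have := fsum _ (index_enum 'I_N) (v 0) (delta_mx 0); rewrite -row_sum_delta.
  congr (T (_ - _)); rewrite mulmx_sum_row; apply: eq_bigr => i _.
  by rewrite rowK.
split=> [v|w]; first split.
- rewrite -fS => Tf; rewrite (_ : v *m F = f v - (f v - v *m F)).
    exact: torsionB Tf (fF v).
  by rewrite opprB addrC subrK.
- by move=> TF; rewrite -fS; have := torsionD (fF v) TF; rewrite subrK.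
- have [v Tv] := fsurj w; exists v.
  by have := torsionD Tv (fF v); rewrite addrA subrK.
Qed.

(** The number of exponents above [j] is the dimension over [k] of
    [t^j M / t^(j+1) M], where [M] is the quotient module. If it were smaller on
    the side of [E], some nonzero combination over [k] of the basis vectors
    with exponent above [j] would be mapped by [F] to a vector whose
    coordinates with exponent above [j] are divisible by [t]; multiplied by
    [t^j] it would vanish modulo [t^(j+1) M]. *)
Lemma count_exponents_le N (E' E : N.-tuple nat) (F : 'M[R]_N) j :
    (j <= n)%N ->
    (forall v, torsion_submodule E' v <-> torsion_submodule E (v *m F)) ->
    (forall w, exists v, torsion_submodule E (w - v *m F)) ->
  (count (fun e => j < e)%N E' <= count (fun e => j < e)%N E)%N.
Proof.
move=> jn FT Fsurj; rewrite -!card_tnth.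
set B' := [set i | _]; set B := [set i | _].
pose M : 'M[k]_N := \matrix_(i, l) ((F i l : {poly k})`_0).
rewrite leqNgt; apply/negP => lt.
have := mxrank_mul_ker (maskmx k B') (M *m maskmx k B).
have rB : (\rank (maskmx k B' *m (M *m maskmx k B)) <= #|B|)%N.
  by rewrite (leq_trans (mxrankM_maxr _ _)) // (leq_trans (mxrankM_maxr _ _)) //
     rank_maskmx.
rewrite rank_maskmx => rk.
have : (maskmx k B' :&: kermx (M *m maskmx k B))%MS != 0.
  by apply/eqP => c0; rewrite c0 mxrank0 addn0 in rk; rewrite rk leqNgt lt in rB.
case/rowV0Pn => a; rewrite sub_capmx => /andP[/submxP[d ad] /sub_kermxP aM] a0.
have aB' i : i \notin B' -> a 0 i = 0.
  by move=> iB'; rewrite ad mulmx_maskE (negPf iB').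
pose a' : 'rV[R]_N := map_mx (in_alg R) a.
have coefa (x : k) (y : R) s : ((x%:A * y : R) : {poly k})`_s = x * (y : {poly k})`_s.
  by rewrite -scalerAl mul1r -coefZ.
have aF i : i \in B -> ((a' *m F) 0 i : {poly k})`_0 = 0.
  move=> iB; transitivity ((a *m (M *m maskmx k B)) 0 i); last by rewrite aM mxE.
  rewrite mulmxA mulmx_maskE iB !mxE coefn_sum; apply: eq_bigr => l _.
  by rewrite !mxE coefa.
pose w : 'rV[R]_N := \row_i trunc_shift 1 ((a' *m F) 0 i).
have Tw : torsion_submodule E ('qX ^+ j *: (a' *m F) - 'qX ^+ j.+1 *: w).
  move=> i; rewrite [_ 0 i](_ : _ = 'qX ^+ j * (a' *m F) 0 i
    - 'qX ^+ j.+1 * trunc_shift 1 ((a' *m F) 0 i)); last first.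
    by rewrite [LHS]mxE [X in X + _]mxE [X in _ + X]mxE [X in - X]mxE [w _ _]mxE.
  have [iB|] := boolP (i \in B).
    exists 0; rewrite mul0r (exprSr ('qX : R)) -mulrA.
    rewrite -['qX * _]/('qX ^+ 1 * _) -trunc_shiftK ?subrr // => s.
    by rewrite ltnS leqn0 => /eqP ->; exact: aF.
  rewrite inE -leqNgt => Ej.
  exists (('qX ^+ (j - tnth E i)) * ((a' *m F) 0 i - 'qX * trunc_shift 1 ((a' *m F) 0 i))).
  by rewrite (exprSr ('qX : R)) -mulrA -mulrBr mulrAC -exprD subnK.
have [v Tv] := Fsurj w.
have : torsion_submodule E (('qX ^+ j *: a' - 'qX ^+ j.+1 *: v) *m F).
  rewrite mulmxBl -!scalemxAl.
  rewrite (_ : _ - _ = 'qX ^+ j *: (a' *m F) - 'qX ^+ j.+1 *: w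
                       + 'qX ^+ j.+1 *: (w - v *m F)).
    exact: torsionD Tw (torsionZ _ Tv).
  by rewrite scalerBr addrA subrK.
rewrite -FT => T'.
case/negP: a0; apply/eqP/rowP => i; rewrite mxE.
have [iB'|/aB'//] := boolP (i \in B').
have [b] := T' i; move: iB'; rewrite inE => ji.
rewrite [LHS]mxE [X in X + _]mxE [X in _ + X]mxE [X in - X]mxE.
rewrite [a' _ _]mxE [b * _]mulrC.
move/(congr1 (fun x : R => (x : {poly k})`_j)).
rewrite coefB !coef_truncXM ltnn /= subr0 leqnn jn subnn (leqNgt (tnth E' i)) ji /=.
by rewrite coefZ coef1 mulr1.
Qed.

Lemma sorted_count_eq (s s' : seq nat) : size s = size s' ->
  sorted leq s -> sorted leq s' ->
  (forall j, count (fun x => j < x)%N s = count (fun x => j < x)%N s') -> s = s'.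
Proof.
move=> ss so so' c; apply: (@eq_from_nth _ 0%N) => // i si.
have cc j : count (fun x => x < j.+1)%N s = count (fun x => x < j.+1)%N s'.
  have e t : count (fun x => x < j.+1)%N t = (size t - count (fun x => j < x)%N t)%N.
    rewrite -(count_predC (fun x => j < x)%N t) addnC addnK.
    by apply: eq_count => x /=; rewrite -leqNgt.
  by rewrite !e ss c.
apply/eqP; rewrite eqn_leq; apply/andP; split; rewrite -ltnS.
  by rewrite sorted_nth_lt // cc -sorted_nth_lt -?ss.
by rewrite sorted_nth_lt -?ss // -cc -sorted_nth_lt.
Qed.

(** Modulo torsion [F] has an inverse [U], given by lifting the basis vectors, so
    the exponents can be compared in both directions. *)
Lemma quotient_isom_torsion_uniq N (E' E : N.-tuple nat) (F : 'M[R]_N) :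
    sorted leq E' -> all (fun a => a <= n.+1)%N E' ->
    sorted leq E -> all (fun a => a <= n.+1)%N E ->
    (forall v, torsion_submodule E' v <-> torsion_submodule E (v *m F)) ->
    (forall w, exists v, torsion_submodule E (w - v *m F)) ->
  E' = E.
Proof.
move=> sE' aE' sE aE FT Fsurj.
have [U' TU] := fin_all_exists (fun i => Fsurj (delta_mx 0 i)).
pose U : 'M[R]_N := \matrix_i U' i.
have TUF (w : 'rV[R]_N) : torsion_submodule E (w - w *m U *m F).
  rewrite -mulmxA -[X in X - _]mulmx1 -mulmxBr mulmx_sum_row.
  apply: torsion_sum => i; apply: torsionZ.
  by rewrite linearB /= row_mul rowK rowE mulmx1.
have UT v : torsion_submodule E v <-> torsion_submodule E' (v *m U).
  rewrite FT; split=> Tv.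
    rewrite (_ : _ *m F = v - (v - v *m U *m F)); last by rewrite opprB addrC subrK.
    exact: torsionB Tv (TUF v).
  by rewrite -(subrK (v *m U *m F) v); apply: torsionD Tv; exact: TUF.
have Usurj w : exists v, torsion_submodule E' (w - v *m U).
  by exists (w *m F); rewrite FT mulmxBl; exact: TUF.
apply/val_inj/sorted_count_eq; rewrite ?size_tuple // => j.
have [jn|nj] := leqP j n.
  by apply/eqP; rewrite eqn_leq (count_exponents_le jn FT) ?(count_exponents_le jn UT).
have c0 (e : N.-tuple nat) : all (fun a => a <= n.+1)%N e -> count (fun x => j < x)%N e = 0%N.
  move=> /allP ae; apply/eqP; rewrite eqn0Ngt -has_count; apply/hasPn => x /ae xn.
  by rewrite -leqNgt (leq_trans xn).
by rewrite !c0.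
Qed.

(** The row space of [J] is carried to that of [diag(t^E)] by an invertible change
    of coordinates. *)
Definition row_equivalent m N (J : 'M[R]_(m, N)) (E : N.-tuple nat) :=
  exists (Q Q' : 'M[R]_N) G H,
  [/\ Q *m Q' = 1%:M, Q' *m Q = 1%:M,
      J = G *m elementary_mx k n E *m Q & elementary_mx k n E *m Q = H *m J].

Lemma row_equivalent_torsion m N (J : 'M[R]_(m, N)) (E : N.-tuple nat) Q Q' G H :
  Q *m Q' = 1%:M -> Q' *m Q = 1%:M ->
  J = G *m elementary_mx k n E *m Q -> elementary_mx k n E *m Q = H *m J ->
  forall v, row_submodule J v <-> torsion_submodule E (v *m Q').
Proof.
move=> QQ' Q'Q JG JH v; rewrite torsion_rowsP; split=> -[c e].
  by exists (c *m G); rewrite e JG -!mulmxA QQ' mulmx1.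
exists (c *m H); rewrite -mulmxA -JH mulmxA -e -mulmxA Q'Q mulmx1 //.
Qed.

Lemma invariants_exist m N (J : 'M[R]_(m, N)) : exists E : N.-tuple nat,
  [/\ sorted leq E, all (fun a => a <= n.+1)%N E
    & quotient_isom (row_submodule J) (@torsion_submodule k n N E)].
Proof.
have [E [Q [Q' [G [H [[sE aE] QQ' Q'Q JG JH]]]]]] := smith_form J.
exists E; split=> //; exists (fun v => v *m Q'); split.
- move=> a u v; rewrite mulmxDl -scalemxAl subrr; exact: torsion0.
- by move=> v; rewrite (row_equivalent_torsion QQ' Q'Q JG JH).
- by move=> w; exists (w *m Q); rewrite -mulmxA QQ' mulmx1 subrr; exact: torsion0.
Qed.

Lemma invariants_row_equivalent m N (J : 'M[R]_(m, N)) (E : N.-tuple nat) :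
  sorted leq E -> all (fun a => a <= n.+1)%N E ->
  quotient_isom (row_submodule J) (@torsion_submodule k n N E) ->
  row_equivalent J E.
Proof.
move=> sE aE isoJ.
have S0 : row_submodule J 0 by exists 0; rewrite mul0mx.
have [F [FT Fsurj]] := quotient_isom_mx S0 isoJ.
have [E' [Q [Q' [G [H [[sE' aE'] QQ' Q'Q JG JH]]]]]] := smith_form J.
suff <- : E' = E by exists Q, Q', G, H.
apply: (@quotient_isom_torsion_uniq _ _ _ (Q *m F)) => // [v|w].
  by rewrite mulmxA -FT (row_equivalent_torsion QQ' Q'Q JG JH) -mulmxA QQ' mulmx1.
have [v Tv] := Fsurj w; exists (v *m Q').
by rewrite mulmxA -(mulmxA v) Q'Q mulmx1.
Qed.

End Invariants.

(** * Restriction of scalars to the ground field *)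

Lemma row_mul_inj (S : pzRingType) m n (A B : 'M[S]_(m, n)) :
  (forall v : 'rV_m, v *m A = v *m B) -> A = B.
Proof. by move=> AB; apply/row_matrixP => i; rewrite !rowE AB. Qed.

Section Coefficients.
Variables (k : closedFieldType) (n : nat).
Local Notation R := (trunc_ring k n).

(** A coefficient of a jet belongs to a variable and to a power of [t], its
    level. *)
Definition jvar N (p : 'I_(N * n.+1)) : 'I_N :=
  (enum_val (cast_ord (esym (mxvec_cast N n.+1)) p)).1.
Definition jlev N (p : 'I_(N * n.+1)) : 'I_n.+1 :=
  (enum_val (cast_ord (esym (mxvec_cast N n.+1)) p)).2.

Lemma jvarE N (i : 'I_N) (u : 'I_n.+1) : jvar (mxvec_index i u) = i.
Proof. by rewrite /jvar /mxvec_index cast_ordK enum_rankK. Qed.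

Lemma jlevE N (i : 'I_N) (u : 'I_n.+1) : jlev (mxvec_index i u) = u.
Proof. by rewrite /jlev /mxvec_index cast_ordK enum_rankK. Qed.

Lemma jet_series_coef N (x : 'rV[k]_(N * n.+1)) i s :
  (jet_series x 0 i : {poly k})`_s
    = if (s <= n)%N then x 0 (mxvec_index i (inord s)) else 0.
Proof.
rewrite mxE coef_in_trunc; case: leqP => // sn.
by rewrite -[in LHS](inordK (sn : s < n.+1)%N) coef_rVpoly_ord !mxE.
Qed.

Lemma jet_coordE N (th : 'rV[R]_N) i u :
  jet_coord th 0 (mxvec_index i u) = (th 0 i : {poly k})`_u.
Proof. by rewrite mxvecE !mxE. Qed.

Lemma jet_coordK N (th : 'rV[R]_N) : jet_series (jet_coord th) = th.
Proof.
apply/rowP => i; apply: truncP => s sn.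
by rewrite jet_series_coef sn jet_coordE inordK.
Qed.

Lemma jet_seriesK N (x : 'rV[k]_(N * n.+1)) : jet_coord (jet_series x) = x.
Proof.
apply/rowP => p; case/mxvec_indexP: p => i u; rewrite jet_coordE jet_series_coef.
by rewrite -ltnS ltn_ord inord_val.
Qed.

Lemma jet_coordD N (a b : 'rV[R]_N) : jet_coord (a + b) = jet_coord a + jet_coord b.
Proof.
apply/rowP => p; case/mxvec_indexP: p => i u.
by rewrite [RHS]mxE !jet_coordE mxE coefD.
Qed.

Lemma jet_coordN N (a : 'rV[R]_N) : jet_coord (- a) = - jet_coord a.
Proof.
apply/rowP => p; case/mxvec_indexP: p => i u.
by rewrite [RHS]mxE !jet_coordE mxE coefN.
Qed.

Lemma jet_coord0 N : jet_coord (0 : 'rV[R]_N) = 0.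
Proof. by rewrite -[0](subrr 0) jet_coordD jet_coordN subrr. Qed.

Lemma jet_seriesB N (x y : 'rV[k]_(N * n.+1)) :
  jet_series (x - y) = jet_series x - jet_series y.
Proof.
apply: (can_inj (@jet_coordK N)).
by rewrite jet_coordD jet_coordN !jet_seriesK.
Qed.

Lemma jet_seriesD N (a : k) (x y : 'rV[k]_(N * n.+1)) :
  jet_series (a *: x + y) = (a%:A : R) *: jet_series x + jet_series y.
Proof.
apply/rowP => i; apply: truncP => s sn.
have -> : ((a%:A : R) *: jet_series x + jet_series y) 0 i
    = a *: jet_series x 0 i + jet_series y 0 i.
  by rewrite [LHS]mxE [X in X + _]mxE -scalerAl mul1r.
by rewrite coefD coefZ !jet_series_coef sn [LHS]mxE [X in X + _]mxE.
Qed.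

Definition series_mul m N (J : 'M[R]_(m, N)) (v : 'rV[k]_(m * n.+1)) :=
  jet_coord (jet_series v *m J).

Lemma series_mul_linear m N (J : 'M[R]_(m, N)) : linear (series_mul J).
Proof.
move=> a u v; rewrite /series_mul jet_seriesD mulmxDl -scalemxAl jet_coordD.
congr (_ + _); apply/rowP => p; case/mxvec_indexP: p => i s.
rewrite [RHS]mxE !jet_coordE; set y := _ *m J.
have -> : (a%:A *: y) 0 i = a *: y 0 i by rewrite [LHS]mxE -scalerAl mul1r.
by rewrite coefZ.
Qed.

HB.instance Definition _ m N (J : 'M[R]_(m, N)) :=
  GRing.isLinear.Build k 'rV[k]_(m * n.+1) 'rV[k]_(N * n.+1) _ (series_mul J)
    (series_mul_linear J).

(** Restriction of scalars from [k[t]/(t^(n+1))] to [k]. *)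
Definition coef_mx m N (J : 'M[R]_(m, N)) : 'M[k]_(m * n.+1, N * n.+1) :=
  lin1_mx (series_mul J).

Lemma mul_coef_mx m N (J : 'M[R]_(m, N)) v :
  v *m coef_mx J = jet_coord (jet_series v *m J).
Proof. by rewrite mul_rV_lin1. Qed.

Lemma coef_mxM m N l (J : 'M[R]_(m, N)) (J' : 'M_(N, l)) :
  coef_mx (J *m J') = coef_mx J *m coef_mx J'.
Proof.
by apply: row_mul_inj => v; rewrite mulmxA !mul_coef_mx jet_coordK mulmxA.
Qed.

Definition power_mx N (d : 'I_N -> nat) : 'M[R]_N := diag_mx (\row_j 'qX ^+ d j).

(** Multiplication by [t^d] shifts coefficients upwards by [d]. *)
Lemma coef_power_mx N (d : 'I_N -> nat) :
  (coef_mx (power_mx d) :=: maskmx k [set p | d (jvar p) <= jlev p]%N)%MS.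
Proof.
set B := [set p | _].
have powE (th : 'rV[R]_N) i : (th *m power_mx d) 0 i = 'qX ^+ d i * th 0 i.
  by rewrite mul_mx_diag !mxE mulrC.
apply/eqmxP/andP; split.
  rewrite (_ : coef_mx _ = coef_mx (power_mx d) *m maskmx k B) ?submxMl //.
  apply: row_mul_inj => v; apply/rowP => p.
  rewrite mulmxA mulmx_maskE inE mul_coef_mx; case/mxvec_indexP: p => i u.
  have un : (u <= n)%N by rewrite -ltnS.
  by rewrite jvarE jlevE jet_coordE powE coef_truncXM un andbT; case: ifP.
pose S v : 'rV[R]_N := \row_i trunc_shift (d i) (jet_series (v *m maskmx k B) 0 i).
have eS v : v *m maskmx k B = jet_coord (S v) *m coef_mx (power_mx d).
  rewrite mul_coef_mx jet_coordK -[LHS]jet_seriesK; congr jet_coord.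
  apply/rowP => i; rewrite powE [S v _ _]mxE -trunc_shiftK // => s si.
  rewrite jet_series_coef mulmx_maskE inE jvarE jlevE; case: leqP => // sn.
  by rewrite inordK // leqNgt si.
by apply/row_subP => p; rewrite rowE eS submxMl.
Qed.

Lemma card_levels N (d : 'I_N -> nat) :
  #|[set p : 'I_(N * n.+1) | d (jvar p) <= jlev p]%N|
    = (\sum_i (n.+1 - d i))%N.
Proof.
rewrite -sum1dep_card big_mkcond (reindex _ (curry_mxvec_bij _ _)) -big_mkcond /=.
rewrite (eq_bigl (fun q : 'I_N * 'I_n.+1 => d q.1 <= q.2)%N); last first.
  by case=> i u; rewrite /= jvarE jlevE.
rewrite -(pair_big_dep xpredT (fun i (u : 'I_n.+1) => d i <= u)%N (fun _ _ => 1%N)) /=.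
apply: eq_bigr => i _; rewrite -(big_mkord (fun u => d i <= u)%N (fun=> 1%N)).
by rewrite -(big_nat_widenl _ 0 _ predT) // sum_nat_const_nat muln1.
Qed.

End Coefficients.

(** * The equations of jets with a given truncation *)

(** Polynomials are generated, as a ring, by constants and variables. *)
Lemma mpoly_ring_ind n (S : nzRingType) (P : {mpoly S[n]} -> Prop) :
    (forall c, P c%:MP) -> (forall i, P 'X_i) ->
    (forall p q, P p -> P q -> P (p + q)) ->
    (forall p q, P p -> P q -> P (p * q)) ->
  forall p, P p.
Proof.
move=> PC PX PD PM; have P1 : P 1 by exact: (PC 1).
elim/mpolyind => [|c m p _ _ Pp]; first by rewrite -mpolyC0.
apply: (PD) => //; rewrite -mul_mpolyC; apply: (PM) => //.
rewrite mpolyXE_id; apply: (big_ind P P1 PM) => i _.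
by elim: (m i) => [|d IH]; rewrite ?expr0 // exprS; apply: PM.
Qed.

(** When all products of increments vanish, both sides are compatible with
    products by the Leibniz rule; no division by factorials occurs, so this
    holds in any characteristic. *)
Lemma mmap_taylor N (K : comNzRingType) (S : comNzRingType) (h : {rmorphism K -> S})
    (v w : 'I_N -> S) (p : {mpoly K[N]}) :
    (forall i j, (w i - v i) * (w j - v j) = 0) ->
  mmap h w p = mmap h v p + \sum_i (w i - v i) * mmap h v p^`M(i).
Proof.
move=> w0; elim/mpoly_ring_ind: p => [c|i|p q IHp IHq|p q IHp IHq].
- rewrite !mmapC big1 ?addr0 // => i _.
  by rewrite mderivC mmap0 mulr0.
- rewrite !mmapX !mmap1U (bigD1 i) //= mderivX mnm1E eqxx scale1r.
  rewrite (_ : (U_(i) - U_(i))%MM = 0%MM) ?mpolyX0 ?rmorph1; last first.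
    by apply/mnmP => j; rewrite mnmBE subnn mnm0E.
  rewrite mulr1 big1 ?addr0 ?subrKC // => j ji.
  by rewrite mderivX mnm1E eq_sym (negPf ji) scale0r raddf0 mulr0.
- rewrite !mmapD IHp IHq addrACA -big_split /=; congr (_ + _).
  by apply: eq_bigr => i _; rewrite mderivD mmapD mulrDr.
have mmapM u p' q' : mmap h u (p' * q') = mmap h u p' * mmap h u q'.
  exact: rmorphM.
rewrite !mmapM IHp IHq mulrDl !mulrDr -!addrA; congr (_ + _).
rewrite [X in _ + (_ + X)](_ : _ = 0); last first.
  rewrite mulr_suml big1 // => i _; rewrite mulr_sumr big1 // => j _.
  by rewrite mulrACA w0 mul0r.
rewrite addr0 mulr_sumr mulr_suml -big_split /=; apply: eq_bigr => i _.
rewrite mderivM mmapD !mmapM mulrDr addrC [X in _ = X + _]mulrA.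
by congr (_ + _); rewrite mulrCA.
Qed.

Section Truncation.
Variables (k : closedFieldType) (N : nat).

Definition series_coef n (x : 'rV[k]_(N * n.+1)) (i : 'I_N) (s : nat) : k :=
  (jet_series x 0 i : {poly k})`_s.

Lemma series_coefE n (x : 'rV[k]_(N * n.+1)) i s :
  series_coef x i s = if (s <= n)%N then x 0 (mxvec_index i (inord s)) else 0.
Proof. exact: jet_series_coef. Qed.

Lemma series_coef_trunc n l (x : 'rV[k]_(N * n.+1)) i s :
  series_coef (jet_trunc l x) i s = if (s <= l)%N then series_coef x i s else 0.
Proof. by rewrite /series_coef /jet_trunc jet_coordK mxE coef_in_trunc mxE. Qed.

Lemma series_coef_inj n (x y : 'rV[k]_(N * n.+1)) :
  (forall i s, (s <= n)%N -> series_coef x i s = series_coef y i s) -> x = y.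
Proof.
move=> xy; apply/rowP => p; case/mxvec_indexP: p => i u.
have un : (u <= n)%N by rewrite -ltnS.
by have := xy i u un; rewrite !series_coefE un inord_val.
Qed.

Lemma jet_trunc_id n (x : 'rV[k]_(N * n.+1)) : jet_trunc n x = x.
Proof. by apply: series_coef_inj => i s sn; rewrite series_coef_trunc sn. Qed.

Lemma jet_trunc_comp n l l' (x : 'rV[k]_(N * n.+1)) :
  (l <= l')%N -> jet_trunc l (jet_trunc l' x) = jet_trunc l x.
Proof.
move=> ll; apply: series_coef_inj => i s sl.
by rewrite !series_coef_trunc sl (leq_trans sl).
Qed.

Lemma jet_trunc_pad n l (x : 'rV[k]_(N * l.+1)) :
  (l <= n)%N -> jet_trunc l (jet_trunc n x) = x.
Proof.
move=> ln; apply: series_coef_inj => i s sl.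
by rewrite !series_coef_trunc sl (leq_trans sl).
Qed.

Lemma jet_trunc_eqP n l (x y : 'rV[k]_(N * n.+1)) :
  jet_trunc l x = jet_trunc l y <->
  (forall p, (jlev p <= l)%N -> x 0 p = y 0 p).
Proof.
split=> [xy p|xy].
  case/mxvec_indexP: p => i u; rewrite jlevE => ul.
  have un : (u <= n)%N by rewrite -ltnS.
  have := congr1 (fun z => series_coef z i u) xy.
  by rewrite /= !series_coef_trunc ul !series_coefE un inord_val.
apply: series_coef_inj => i s sl; rewrite !series_coef_trunc sl !series_coefE.
by case: leqP => // sn; rewrite xy // jlevE inordK.
Qed.

End Truncation.

Section JetEquations.
Variables (k : closedFieldType) (N n l0 : nat).
Hypothesis nl0 : (n < l0.+1 + l0.+1)%N.
Local Notation R := (trunc_ring k n).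
Implicit Types (x y : 'rV[k]_(N * n.+1)).

Lemma low_mul0 (a b : R) :
    (forall s, (s < l0.+1)%N -> (a : {poly k})`_s = 0) ->
    (forall s, (s < l0.+1)%N -> (b : {poly k})`_s = 0) ->
  a * b = 0.
Proof.
move=> /trunc_shiftK -> /trunc_shiftK ->.
by rewrite mulrACA -exprD truncX0 ?mul0r.
Qed.

Definition jet_base x : 'rV[k]_(N * n.+1) := jet_trunc n (jet_trunc l0 x).

Lemma series_coef_base x i s :
  series_coef (jet_base x) i s = if (s <= l0)%N then series_coef x i s else 0.
Proof.
rewrite /jet_base !series_coef_trunc; case: leqP => // sn.
by rewrite series_coefE (leqNgt s n) sn if_same.
Qed.

Lemma jet_base_low x i s : (s < l0.+1)%N ->
  (jet_series x 0 i - jet_series (jet_base x) 0 i : {poly k})`_s = 0.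
Proof.
move=> sl; rewrite coefB -/(series_coef x i s) -/(series_coef (jet_base x) i s).
by rewrite series_coef_base -ltnS sl subrr.
Qed.

Lemma jet_eval_taylor (p : {mpoly k[N]}) x :
  jet_eval p x = jet_eval p (jet_base x)
    + \sum_i (jet_series x 0 i - jet_series (jet_base x) 0 i)
             * jet_eval p^`M(i) (jet_base x).
Proof.
rewrite /jet_eval; apply: mmap_taylor => i j.
by apply: low_mul0 => s; exact: jet_base_low.
Qed.

Lemma jet_eval_base_low (p : {mpoly k[N]}) x s : (s < l0.+1)%N ->
  (jet_eval p x - jet_eval p (jet_base x) : {poly k})`_s = 0.
Proof.
move=> sl; rewrite jet_eval_taylor addrC addKr.
have [sn|ns] := leqP s n; last by rewrite coef_trunc_big.
rewrite coefn_sum big1 // => i _; rewrite coef_truncM // big1 // => j _.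
by rewrite jet_base_low ?mul0r // (leq_ltn_trans _ sl) // -ltnS.
Qed.

Section Equations.
Variables (m : nat) (f : m.-tuple {mpoly k[N]}).

Definition jet_values x : 'rV[k]_(m * n.+1) :=
  jet_coord (\row_q jet_eval (tnth f q) x).

(** The matrix and the right-hand side of the equations of [f], which are affine
    linear on jets with a fixed truncation to level [l0]. Both are evaluated at
    [jet_base x], so that they depend on [x] only through that truncation. *)
Definition jet_mx x := coef_mx (jet_jacobian f (jet_base x))^T.

Definition jet_rhs x := jet_base x *m jet_mx x - jet_values (jet_base x).

Lemma jets_values x : jets f x <-> jet_values x = 0.
Proof.
split=> [fx|fx p [c ->]].
  rewrite /jet_values (_ : \row_q _ = 0) ?jet_coord0 //; apply/rowP => q.
  rewrite !mxE; apply: fx; exists (fun q' => (q' == q)%:R).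
  rewrite (bigD1 q) //= eqxx mul1r big1 ?addr0 // => q' /negPf ->.
  by rewrite mul0r.
have {}fx q : jet_eval (tnth f q) x = 0.
  have := congr1 (fun v => jet_series v 0 q) fx.
  by rewrite /= jet_coordK mxE => ->; rewrite -jet_coord0 jet_coordK mxE.
rewrite /jet_eval raddf_sum big1 // => q _ /=.
by rewrite rmorphM [X in _ * X]fx mulr0.
Qed.

Lemma jet_values_taylor x :
  jet_values x = jet_values (jet_base x) + (x - jet_base x) *m jet_mx x.
Proof.
rewrite /jet_mx mul_coef_mx /jet_values -jet_coordD; congr jet_coord.
apply/rowP => q; rewrite mxE jet_eval_taylor [RHS]mxE mxE; congr (_ + _).
rewrite [RHS]mxE; apply: eq_bigr => i _.
by congr (_ * _); rewrite ?jet_seriesB [RHS]mxE; [congr (_ + _) | ]; rewrite [RHS]mxE.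
Qed.

Lemma jets_linear x : jets f x <-> x *m jet_mx x = jet_rhs x.
Proof.
rewrite jets_values jet_values_taylor mulmxBl /jet_rhs; split=> [h|->].
  apply/eqP; rewrite -subr_eq0 opprB addrA addrAC -h addrC.
  by rewrite addrCA addrA.
by rewrite addrAC subrr add0r addrN.
Qed.

(** The Jacobian matrices at [x] and at [jet_base x] differ by multiples of
    [t^(l0+1)], and on unknowns of level above [c >= l0] they are multiplied by
    another factor [t^(l0+1)], whose square is zero. *)
Lemma jet_mx_base c x : (l0 <= c)%N ->
  maskmx k [set p | c < jlev p]%N *m jet_mx x
    = maskmx k [set p | c < jlev p]%N *m coef_mx (jet_jacobian f x)^T.
Proof.
move=> lc; apply: row_mul_inj => v.
have vJ (J : 'M[R]_(N, m)) : v *m (maskmx k [set p | c < jlev p]%N *m coef_mx J)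
    = jet_coord (jet_series (v *m maskmx k [set p | c < jlev p]%N) *m J).
  by rewrite mulmxA mul_coef_mx.
apply: etrans (vJ _) (etrans _ (esym (vJ _))); set y := jet_series _.
have ylow i s : (s < l0.+1)%N -> (y 0 i : {poly k})`_s = 0.
  move=> sl; rewrite jet_series_coef; case: leqP => // sn.
  by rewrite mulmx_maskE inE jlevE inordK // ltnNge (leq_trans _ lc).
congr jet_coord; apply/rowP => q; rewrite [LHS]mxE [RHS]mxE; apply: eq_bigr => i _.
apply/eqP; rewrite eq_sym -subr_eq0 -mulrBr; apply/eqP/low_mul0 => s sl.
  exact: ylow.
rewrite [X in X - _]mxE [X in _ - X]mxE [X in X - _]mxE [X in _ - X]mxE.
exact: jet_eval_base_low.
Qed.

End Equations.
End JetEquations.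

(** * The strata as rank conditions *)

Lemma rank_coef_mx_mul (k : closedFieldType) n m N p q (A : 'M[trunc_ring k n]_(m, N))
    (B : 'M_(N, p)) (C : 'M_(p, q)) :
  (\rank (coef_mx (A *m B *m C)) <= \rank (coef_mx B))%N.
Proof.
rewrite coef_mxM coef_mxM (leq_trans (mxrankM_maxl _ _)) //.
exact: mxrankM_maxr.
Qed.

(** Keeping the unknowns of level above [c] amounts to multiplying by [t^(c+1)],
    and the rank is then that of [t^(c+1) diag(t^E)], since each of the two
    matrices is a multiple of the other. That diagonal matrix shifts the
    coefficients of the [i]-th variable by [c + 1 + E_i], so [n - c - E_i] of
    them survive (none if this is negative). *)
Lemma rank_coef_mx_level (k : closedFieldType) n m N
    (J : 'M[trunc_ring k n]_(m, N)) (E : N.-tuple nat) c :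
  row_equivalent J E ->
  \rank (maskmx k [set p | c < jlev p]%N *m coef_mx J^T)
    = (\sum_(y <- E) (n - c - y))%N.
Proof.
case=> Q [Q' [G [H [QQ' Q'Q JG JH]]]]; set D := elementary_mx k n E in JG JH.
pose t : trunc_ring k n := 'qX ^+ c.+1.
have powt : power_mx k n (fun=> c.+1) = t%:M :> 'M[trunc_ring k n]_N.
  by rewrite -diag_const_mx; congr diag_mx; apply/rowP => j; rewrite !mxE.
have -> : \rank (maskmx k [set p | c < jlev p]%N *m coef_mx J^T)
        = \rank (coef_mx (t *: J^T)).
  by rewrite -mul_scalar_mx -powt coef_mxM (eqmxMr _ (coef_power_mx k n (fun=> c.+1))).
have DT : D^T = D by rewrite /D /elementary_mx tr_diag_mx.
have JT : J^T = Q^T *m D *m G^T by rewrite JG !trmx_mul DT mulmxA.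
have QD : Q^T *m D = J^T *m H^T by rewrite -[in LHS]DT -!trmx_mul JH.
have -> : \rank (coef_mx (t *: J^T)) = \rank (coef_mx (t *: D)).
  have QT : Q'^T *m Q^T = 1%:M by rewrite -trmx_mul QQ' trmx1.
  have e1 : t *: J^T = Q^T *m (t *: D) *m G^T.
    by rewrite JT -scalemxAr -scalemxAl.
  have e2 : t *: D = Q'^T *m (t *: J^T) *m H^T.
    by rewrite -scalemxAr -scalemxAl -mulmxA -QD mulmxA QT mul1mx.
  apply/eqP; rewrite eqn_leq; apply/andP; split.
    by rewrite e1 rank_coef_mx_mul.
  by rewrite e2 rank_coef_mx_mul.
have -> : t *: D = power_mx k n (fun i => c.+1 + tnth E i)%N.
  by apply/matrixP => i j; rewrite !mxE mulrnAr -exprD.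
rewrite coef_power_mx rank_maskmx (card_levels n (fun i => c.+1 + tnth E i)%N) big_tuple.
apply: eq_bigr => i _.
by rewrite addSn subSS subnDA.
Qed.

Lemma sum_subn_count j (s : seq nat) :
  (\sum_(y <- s) (j.+1 - y) = \sum_(y <- s) (j - y) + count (fun y => y < j.+1) s)%N.
Proof.
elim: s => [|y s IH]; first by rewrite !big_nil.
rewrite !big_cons IH /= addnACA; congr (_ + _)%N.
case: ltnP => [yj|jy]; first by rewrite subSn ?addn1.
have -> : (j.+1 - y = 0)%N by apply/eqP; rewrite subn_eq0.
by have -> : (j - y = 0)%N by apply/eqP; rewrite subn_eq0 ltnW.
Qed.

(** The increments in [j] of the sums of truncated differences [j - y] count the
    terms below [j + 1], and for sorted sequences these counts give back the
    terms below [g]. *)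
Lemma sorted_prefixP g (E e : seq nat) :
  sorted leq E -> sorted leq e -> all (fun a => a < g)%N e ->
  (size e <= size E)%N ->
  ((forall i, (i < size e)%N -> nth 0%N E i = nth 0%N e i) /\
     ((size e < size E)%N -> (g <= nth 0%N E (size e))%N))
  <-> (forall j, (j <= g)%N ->
         \sum_(y <- E) (j - y) = \sum_(y <- e) (j - y))%N.
Proof.
move=> sE se /allP eg seE; split=> [[Ee Eg] j jg|sums].
  have <- : take (size e) E = e.
    apply: (@eq_from_nth _ 0%N) => [|i]; rewrite size_takel // => ie.
    by rewrite nth_take // Ee.
  rewrite -[in LHS](cat_take_drop (size e) E) big_cat /=.
  rewrite [X in (_ + X)%N]big1_seq ?addn0 // => y /andP[_ /(nthP 0%N)[i]].
  rewrite size_drop nth_drop => ilt <-; apply/eqP; rewrite subn_eq0.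
  have lt : (size e + i < size E)%N by rewrite -ltn_subRL.
  apply: (leq_trans jg); apply: (leq_trans (Eg _)).
    by rewrite (leq_ltn_trans _ lt) ?leq_addr.
  apply: sorted_leq_nth => //; rewrite ?leq_addr ?inE //.
    exact: leq_trans.
  by rewrite (leq_ltn_trans _ lt) ?leq_addr.
have counts j : (j <= g)%N ->
    count (fun y => y < j)%N E = count (fun y => y < j)%N e.
  case: j => [|j] jg; first by rewrite !(eq_count (a2 := pred0)) ?count_pred0.
  have := sums _ jg; rewrite !sum_subn_count sums ?(ltnW jg) //.
  by move/addnI.
split=> [i ie|lt].
  have iE := leq_trans ie seE; have ig := eg _ (mem_nth 0%N ie).
  have H j : (j <= g)%N -> (nth 0 E i < j)%N = (nth 0 e i < j)%N.
    by move=> jg; rewrite !sorted_nth_lt // counts.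
  have Eig : (nth 0 E i < g)%N by rewrite H.
  have := H _ ig; rewrite ltnSn ltnS => le1.
  have := H _ Eig; rewrite ltnSn ltnS => le2.
  by apply/eqP; rewrite eqn_leq le1 -le2.
by rewrite leqNgt sorted_nth_lt // counts // ltnNge count_size.
Qed.

Section Stratum.
Variables (k : closedFieldType) (N n l0 g b m : nat).
Variables (e : b.-tuple nat) (f : m.-tuple {mpoly k[N]}).
Hypotheses (nl0 : (n < l0.+1 + l0.+1)%N) (l0n : (l0 <= n)%N) (gE : g = (n - l0)%N).
Hypotheses (se : sorted leq e) (eg : all (fun a => a < g)%N e) (bN : (b <= N)%N).

Definition level_rank c := (\sum_(y <- e) (n - c - y))%N.

(** The invariants enter only through the ranks, for [l0 <= c <= n], which is the
    range where invariants that are at least [g] do not contribute. *)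
Lemma jet_stratumP (x : 'rV[k]_(N * n.+1)) :
  jet_stratum g f e x <->
  x *m jet_mx l0 f x = jet_rhs l0 f x /\
  forall c, (l0 <= c <= n)%N ->
    \rank (maskmx k [set p | c < jlev p]%N *m jet_mx l0 f x) = level_rank c.
Proof.
rewrite -jets_linear //.
have rk (E : N.-tuple nat) c : (l0 <= c)%N -> jet_invariants f x E ->
    \rank (maskmx k [set p | c < jlev p]%N *m jet_mx l0 f x)
      = (\sum_(y <- E) (n - c - y))%N.
  move=> lc [sE aE isoE]; rewrite jet_mx_base //.
  by apply: rank_coef_mx_level; exact: invariants_row_equivalent.
have prefix (E : N.-tuple nat) : sorted leq E ->
    ((forall i, (i < b)%N -> nth 0%N E i = nth 0%N e i) /\
     ((b < N)%N -> (g <= nth 0%N E b)%N)) <->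
    (forall c, (l0 <= c <= n)%N -> (\sum_(y <- E) (n - c - y))%N = level_rank c).
  move=> sE; have := sorted_prefixP sE se eg; rewrite !size_tuple => /(_ bN) ->.
  split=> [H c /andP[lc cn]|H j jg]; first by apply: H; rewrite gE leq_sub2l.
  have jn : (j <= n)%N by rewrite (leq_trans jg) // gE leq_subr.
  have := H (n - j)%N; rewrite leq_subr andbT /level_rank subKn //; apply.
  by rewrite -(subKn l0n) leq_sub2l // -gE.
split=> [[fx [E [invE Ee Eg]]]|[fx rks]]; split=> //.
  move=> c /andP[lc cn]; have [sE _ _] := invE; rewrite (rk E) //.
  by have [H _] := prefix E sE; apply: H => //; rewrite lc.
have [E [sE aE isoE]] := invariants_exist (jet_jacobian f x).
have [_ /(_ _)[|Ee Eg]] := prefix E sE.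
  by move=> c cc; have /andP[lc _] := cc; rewrite -(rks c cc) (rk E).
by exists E.
Qed.

End Stratum.

(** * Polynomial maps and rank loci *)

(** Testing all products [U *m A *m V] instead of the minors of [A] avoids selecting
    rows and columns; it gives the same closed set since closed sets may be cut
    out by infinitely many polynomials. *)
Lemma rank_le_det (F : fieldType) p q r (A : 'M[F]_(p, q)) :
  (\rank A <= r)%N <->
  forall (U : 'M_(r.+1, p)) (V : 'M_(q, r.+1)), \det (U *m A *m V) = 0.
Proof.
split=> [rA U V|dA].
  apply/eqP; rewrite -[_ == 0]negbK -unitfE -unitmxE -row_free_unit -row_leq_rank.
  rewrite -ltnNge ltnS (leq_trans (mxrankM_maxl _ _)) //.
  by rewrite (leq_trans (mxrankM_maxr _ _)).
rewrite leqNgt; apply/negP => lt; move: dA.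
have rp := leq_trans lt (rank_leq_row A); have rq := leq_trans lt (rank_leq_col A).
move: (mulmx_ebase A) (col_ebase_unit A) (row_ebase_unit A) lt.
move: (col_ebase A) (row_ebase A) (\rank A) => L M rk <- uL uM lt.
move/(_ (pid_mx r.+1 *m invmx L) (invmx M *m pid_mx r.+1)).
rewrite -!mulmxA mulKmx // mulKVmx // !mul_pid_mx.
rewrite !(minn_idPr _) ?(minn_idPl _) // ?leq_min ?leqnn ?rp ?rq ?lt //.
by rewrite pid_mx_1 det1 => /eqP; rewrite oner_eq0.
Qed.

Section PolynomialMaps.
Variable k : closedFieldType.

Definition polyfun d (phi : 'rV[k]_d -> k) :=
  exists P : {mpoly k[d]}, forall x, phi x = P.@[x 0].

Lemma polyfun_eq d (phi psi : 'rV[k]_d -> k) :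
  phi =1 psi -> polyfun phi -> polyfun psi.
Proof. by move=> e [P eP]; exists P => x; rewrite -e. Qed.

Lemma polyfun_const d (a : k) : polyfun (fun _ : 'rV[k]_d => a).
Proof. by exists a%:MP => x; rewrite mevalC. Qed.

Lemma polyfun_coord d (i : 'I_d) : polyfun (fun x : 'rV[k]_d => x 0 i).
Proof. by exists 'X_i => x; rewrite mevalXU. Qed.

Lemma polyfunD d (phi psi : 'rV[k]_d -> k) :
  polyfun phi -> polyfun psi -> polyfun (fun x => phi x + psi x).
Proof. by move=> [P eP] [Q eQ]; exists (P + Q) => x; rewrite mevalD eP eQ. Qed.

Lemma polyfunM d (phi psi : 'rV[k]_d -> k) :
  polyfun phi -> polyfun psi -> polyfun (fun x => phi x * psi x).
Proof. by move=> [P eP] [Q eQ]; exists (P * Q) => x; rewrite mevalM eP eQ. Qed.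

Lemma polyfunN d (phi : 'rV[k]_d -> k) :
  polyfun phi -> polyfun (fun x => - phi x).
Proof. by move=> [P eP]; exists (- P) => x; rewrite mevalN eP. Qed.

Lemma polyfun_sum d I (r : seq I) (P : pred I) (phi : I -> 'rV[k]_d -> k) :
  (forall i, polyfun (phi i)) -> polyfun (fun x => \sum_(i <- r | P i) phi i x).
Proof.
move=> pphi; elim: r => [|i r IH].
  by apply: polyfun_eq (polyfun_const d 0) => x; rewrite big_nil.
case: (boolP (P i)) => Pi.
  by apply: polyfun_eq (polyfunD (pphi i) IH) => x; rewrite big_cons Pi.
by apply: polyfun_eq IH => x; rewrite big_cons (negPf Pi).
Qed.

Lemma polyfun_prod d I (r : seq I) (phi : I -> 'rV[k]_d -> k) :
  (forall i, polyfun (phi i)) -> polyfun (fun x => \prod_(i <- r) phi i x).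
Proof.
move=> pphi; elim: r => [|i r IH].
  by apply: polyfun_eq (polyfun_const d 1) => x; rewrite big_nil.
by apply: polyfun_eq (polyfunM (pphi i) IH) => x; rewrite big_cons.
Qed.

Definition polymx d p q (A : 'rV[k]_d -> 'M[k]_(p, q)) :=
  forall i j, polyfun (fun x => A x i j).

Lemma polymx_const d p q (A : 'M[k]_(p, q)) : polymx (fun _ : 'rV[k]_d => A).
Proof. by move=> i j; exact: polyfun_const. Qed.

Lemma polymx_id d : polymx (fun x : 'rV[k]_d => x).
Proof. by move=> i j; rewrite ord1; exact: polyfun_coord. Qed.

Lemma polymxD d p q (A B : 'rV[k]_d -> 'M[k]_(p, q)) :
  polymx A -> polymx B -> polymx (fun x => A x + B x).
Proof.
by move=> pA pB i j; apply: polyfun_eq (polyfunD (pA i j) (pB i j)) => x;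
   rewrite mxE.
Qed.

Lemma polymxN d p q (A : 'rV[k]_d -> 'M[k]_(p, q)) :
  polymx A -> polymx (fun x => - A x).
Proof.
by move=> pA i j; apply: polyfun_eq (polyfunN (pA i j)) => x; rewrite mxE.
Qed.

Lemma polymxM d p q r (A : 'rV[k]_d -> 'M[k]_(p, q)) (B : 'rV[k]_d -> 'M[k]_(q, r)) :
  polymx A -> polymx B -> polymx (fun x => A x *m B x).
Proof.
move=> pA pB i j; pose phi l x := A x i l * B x l j.
have pphi l : polyfun (phi l) by exact: polyfunM.
by apply: polyfun_eq (polyfun_sum (index_enum 'I_q) predT pphi) => x; rewrite mxE.
Qed.

Lemma polymxZ d p q (a : 'rV[k]_d -> k) (A : 'rV[k]_d -> 'M[k]_(p, q)) :
  polyfun a -> polymx A -> polymx (fun x => a x *: A x).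
Proof.
by move=> pa pA i j; apply: polyfun_eq (polyfunM pa (pA i j)) => x; rewrite mxE.
Qed.

Lemma polymx_det d p (A : 'rV[k]_d -> 'M[k]_p) :
  polymx A -> polyfun (fun x => \det (A x)).
Proof.
move=> pA; apply: polyfun_sum => s; apply: polyfunM; first exact: polyfun_const.
by apply: polyfun_prod => i; exact: pA.
Qed.

Lemma polymx_adj d p (A : 'rV[k]_d -> 'M[k]_p) :
  polymx A -> polymx (fun x => \adj (A x)).
Proof.
move=> pA i j.
apply: (@polyfun_eq _ (fun x => (-1) ^+ (j + i) * \det (row' j (col' i (A x))))).
  by move=> x; rewrite mxE.
apply: polyfunM; first exact: polyfun_const.
apply: polymx_det => i' j'; apply: polyfun_eq (pA (lift j i') (lift i j')) => x.
by rewrite !mxE.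
Qed.

Lemma polymx_col_mx d p p' q (A : 'rV[k]_d -> 'M[k]_(p, q))
    (B : 'rV[k]_d -> 'M[k]_(p', q)) :
  polymx A -> polymx B -> polymx (fun x => col_mx (A x) (B x)).
Proof.
move=> pA pB i j; case: (split_ordP i) => i' ->.
  by apply: polyfun_eq (pA i' j) => x; rewrite col_mxEu.
by apply: polyfun_eq (pB i' j) => x; rewrite col_mxEd.
Qed.

Lemma polymx_row_mx d p q q' (A : 'rV[k]_d -> 'M[k]_(p, q))
    (B : 'rV[k]_d -> 'M[k]_(p, q')) :
  polymx A -> polymx B -> polymx (fun x => row_mx (A x) (B x)).
Proof.
move=> pA pB i j; case: (split_ordP j) => j' ->.
  by apply: polyfun_eq (pA i j') => x; rewrite row_mxEl.
by apply: polyfun_eq (pB i j') => x; rewrite row_mxEr.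
Qed.

Lemma polymx_lsubmx q r : polymx (fun x : 'rV[k]_(q + r) => lsubmx x).
Proof.
move=> i j; apply: polyfun_eq (polymx_id i (lshift r j)) => x.
by rewrite mxE.
Qed.

Lemma polymx_rsubmx q r : polymx (fun x : 'rV[k]_(q + r) => rsubmx x).
Proof.
move=> i j; apply: polyfun_eq (polymx_id i (rshift q j)) => x.
by rewrite mxE.
Qed.

Lemma polyfun_comp d d' (phi : 'rV[k]_d' -> k) (g : 'rV[k]_d -> 'rV[k]_d') :
  polyfun phi -> polymx g -> polyfun (fun x => phi (g x)).
Proof.
move=> [P eP] pg; apply: (@polyfun_eq _ (fun x => P.@[g x 0])) => [x|].
  by rewrite eP.
elim/mpoly_ring_ind: P {eP} => [c|i|p q IHp IHq|p q IHp IHq].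
- by apply: polyfun_eq (polyfun_const d c) => x; rewrite mevalC.
- by apply: polyfun_eq (pg 0 i) => x; rewrite mevalXU.
- by apply: polyfun_eq (polyfunD IHp IHq) => x; rewrite mevalD.
- by apply: polyfun_eq (polyfunM IHp IHq) => x; rewrite mevalM.
Qed.

Lemma polymx_comp d d' p q (A : 'rV[k]_d' -> 'M[k]_(p, q)) (g : 'rV[k]_d -> 'rV[k]_d') :
  polymx A -> polymx g -> polymx (fun x => A (g x)).
Proof. by move=> pA pg i j; exact: (polyfun_comp (pA i j) pg). Qed.

Lemma regular_frac d r (S : 'rV[k]_d -> Prop) (phi num : 'rV[k]_d -> 'rV[k]_r)
    (den : 'rV[k]_d -> k) :
    polyfun den -> polymx num -> (forall x, S x -> den x != 0) ->
    (forall x, S x -> phi x = (den x)^-1 *: num x) ->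
  regular_on S phi.
Proof.
move=> [Q eQ] pnum den0 ephi x Sx j; have [P eP] := pnum 0 j.
exists P, Q; split=> [|y Sy _]; first by rewrite -eQ den0.
by rewrite ephi // mxE -eP -eQ mulrC.
Qed.

Lemma regular_polymx d r (S : 'rV[k]_d -> Prop) (phi : 'rV[k]_d -> 'rV[k]_r) :
  polymx phi -> regular_on S phi.
Proof.
move=> pphi; apply: (regular_frac (polyfun_const d 1) pphi) => x _.
  exact: oner_neq0.
by rewrite invr1 scale1r.
Qed.

(** The canonical choice of equations, all polynomials vanishing on [C], avoids
    choosing equations for the members of a family. *)
Lemma zclosedP d (C : 'rV[k]_d -> Prop) :
  zclosed C <-> forall x : 'rV[k]_d, (forall p : {mpoly k[d]},
    (forall y : 'rV[k]_d, C y -> p.@[y 0] = 0) -> p.@[x 0] = 0) -> C x.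
Proof.
split=> [[F eC] x h|h].
  by apply/eC => p Fp; apply: h => y /eC; apply.
exists (fun p => forall y : 'rV[k]_d, C y -> p.@[y 0] = 0) => x; split=> [Cx p|]; last exact: h.
by apply.
Qed.

Lemma zclosed_iff d (C D : 'rV[k]_d -> Prop) :
  (forall x, C x <-> D x) -> zclosed C -> zclosed D.
Proof. by move=> e [F eC]; exists F => x; rewrite -e. Qed.

Lemma zclosed_forall d I (C : I -> 'rV[k]_d -> Prop) :
  (forall i, zclosed (C i)) -> zclosed (fun x => forall i, C i x).
Proof.
move=> cC; apply/zclosedP => x h i; have /zclosedP := cC i; apply => p pC.
by apply: h => y Cy; exact: pC.
Qed.

Lemma zclosed_or d (C D : 'rV[k]_d -> Prop) :
  zclosed C -> zclosed D -> zclosed (fun x => C x \/ D x).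
Proof.
move=> /zclosedP cC /zclosedP cD; apply/zclosedP => x h.
case: (classic (D x)) => [|nDx]; [by right | left].
apply: cC => p pC; apply: NNPP => px; apply: nDx; apply: cD => q qD.
have pq y : C y \/ D y -> (p * q).@[y 0] = 0.
  by rewrite mevalM => -[/pC->|/qD->]; rewrite ?mul0r ?mulr0.
have /eqP := h _ pq; rewrite mevalM mulf_eq0.
by case/orP => /eqP.
Qed.

Lemma zclosed_polyfun d (phi : 'rV[k]_d -> k) :
  polyfun phi -> zclosed (fun x => phi x = 0).
Proof.
move=> [P eP]; exists (eq P) => x; rewrite eP.
by split=> [e p <- //|]; exact.
Qed.

Lemma zclosed_rank_le d p q (A : 'rV[k]_d -> 'M[k]_(p, q)) r :
  polymx A -> zclosed (fun x => \rank (A x) <= r)%N.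
Proof.
move=> pA; apply: (@zclosed_iff _ (fun x =>
   forall (UV : 'M_(r.+1, p) * 'M_(q, r.+1)), \det (UV.1 *m A x *m UV.2) = 0)).
  move=> x; rewrite rank_le_det; split=> [h U V|h [U V]]; first exact: (h (U, V)).
  exact: h.
apply: zclosed_forall => -[U V]; apply/zclosed_polyfun/polymx_det.
exact: polymxM (polymxM (polymx_const _ _) pA) (polymx_const _ _).
Qed.

Lemma zopen_rank_ge d p q (A : 'rV[k]_d -> 'M[k]_(p, q)) r :
  polymx A -> zopen (fun x => r <= \rank (A x))%N.
Proof.
move=> pA; case: r => [|r].
  by exists (eq (1 : {mpoly k[d]})) => x; split=> [//|/(_ 1 erefl)/eqP]; rewrite meval1 oner_eq0.
apply: zclosed_iff (zclosed_rank_le r pA) => x.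
by rewrite leqNgt; split=> /negP.
Qed.

Lemma zopen_polyfun_neq0 d (phi : 'rV[k]_d -> k) :
  polyfun phi -> zopen (fun x => phi x != 0).
Proof.
move=> pphi; apply: zclosed_iff (zclosed_polyfun pphi) => x.
by split=> [->|/negP]; rewrite ?eqxx // negbK => /eqP.
Qed.

Lemma zopen_forall_seq d (I : eqType) (s : seq I) (U : I -> 'rV[k]_d -> Prop) :
  (forall i, zopen (U i)) -> zopen (fun x => forall i, i \in s -> U i x).
Proof.
move=> oU; elim: s => [|i s IH].
  exists (eq (1 : {mpoly k[d]})) => x; split=> [[]//|/(_ 1 erefl)/eqP].
  by rewrite meval1 oner_eq0.
apply: zclosed_iff (zclosed_or (oU i) IH) => x; split.
  case=> h h'; apply: h; first by apply: h'; rewrite mem_head.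
  by move=> j js; apply: h'; rewrite inE js orbT.
move=> h; case: (classic (U i x)) => [Ui|nUi]; last by left.
right=> hs; apply: h => j; rewrite inE => /orP[/eqP->//|]; exact: hs.
Qed.

End PolynomialMaps.

Section PolynomialJets.
Variables (k : closedFieldType) (n d : nat).
Local Notation R := (trunc_ring k n).

Definition polyseries (phi : 'rV[k]_d -> R) :=
  forall s, (s <= n)%N -> polyfun (fun x => (phi x : {poly k})`_s).

Lemma polyseries_const (a : R) : polyseries (fun=> a).
Proof. by move=> s _; exact: polyfun_const. Qed.

Lemma polyseriesD (phi psi : 'rV[k]_d -> R) :
  polyseries phi -> polyseries psi -> polyseries (fun x => phi x + psi x).
Proof.
move=> pphi ppsi s sn; apply: polyfun_eq (polyfunD (pphi s sn) (ppsi s sn)) => x.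
by rewrite coefD.
Qed.

Lemma polyseriesM (phi psi : 'rV[k]_d -> R) :
  polyseries phi -> polyseries psi -> polyseries (fun x => phi x * psi x).
Proof.
move=> pphi ppsi s sn.
pose F (i : 'I_s.+1) x := (phi x : {poly k})`_i * (psi x : {poly k})`_(s - i).
have pF i : polyfun (F i).
  apply: polyfunM; first by apply: pphi; rewrite (leq_trans _ sn) // -ltnS.
  by apply: ppsi; rewrite (leq_trans (leq_subr _ _) sn).
apply: polyfun_eq (polyfun_sum (index_enum 'I_s.+1) predT pF) => x.
by rewrite coef_truncM.
Qed.

Lemma polyseries_sum I (r : seq I) (phi : I -> 'rV[k]_d -> R) :
  (forall i, polyseries (phi i)) -> polyseries (fun x => \sum_(i <- r) phi i x).
Proof.
move=> pphi s sn; apply: polyfun_eq (polyfun_sum r predT (fun i => pphi i s sn)) => x.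
by rewrite coefn_sum.
Qed.

Lemma polyseries_jet N (y : 'rV[k]_d -> 'rV[k]_(N * n.+1)) i :
  polymx y -> polyseries (fun x => jet_series (y x) 0 i).
Proof.
move=> py s sn; apply: polyfun_eq (py 0 (mxvec_index i (inord s))) => x.
by rewrite jet_series_coef sn.
Qed.

Lemma polyseries_jet_eval N (p : {mpoly k[N]}) (y : 'rV[k]_d -> 'rV[k]_(N * n.+1)) :
  polymx y -> polyseries (fun x => jet_eval p (y x)).
Proof.
move=> py; elim/mpoly_ring_ind: p => [c|i|p q IHp IHq|p q IHp IHq].
- move=> s sn; apply: polyfun_eq (polyseries_const c%:A sn) => x.
  by rewrite /jet_eval mmapC.
- move=> s sn; apply: polyfun_eq (polyseries_jet i py sn) => x.
  by rewrite /jet_eval mmapX mmap1U.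
- move=> s sn; apply: polyfun_eq (polyseriesD IHp IHq sn) => x.
  by rewrite /jet_eval mmapD.
- move=> s sn; apply: polyfun_eq (polyseriesM IHp IHq sn) => x.
  by rewrite /jet_eval -rmorphM.
Qed.

Lemma polymx_jet_coord N (th : 'rV[k]_d -> 'rV[R]_N) :
  (forall i, polyseries (fun x => th x 0 i)) -> polymx (fun x => jet_coord (th x)).
Proof.
move=> pth i p; rewrite ord1; case/mxvec_indexP: p => j u.
have un : (u <= n)%N by rewrite -ltnS.
by apply: polyfun_eq (pth j u un) => x; rewrite jet_coordE.
Qed.

Lemma polymx_coef_mx m N (J : 'rV[k]_d -> 'M[R]_(m, N)) :
  (forall i j, polyseries (fun x => J x i j)) -> polymx (fun x => coef_mx (J x)).
Proof.
move=> pJ i j.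
apply: (@polyfun_eq _ _ (fun x => jet_coord (jet_series (delta_mx 0 i) *m J x) 0 j)).
  by move=> x; rewrite -mul_coef_mx -rowE mxE.
apply: polymx_jet_coord => l s sn.
pose F q x := jet_series (delta_mx 0 i : 'rV[k]_(m * n.+1)) 0 q * J x q l.
have pF q : polyseries (F q) by apply: polyseriesM => //; exact: polyseries_const.
by apply: polyfun_eq (polyseries_sum (index_enum 'I_m) pF sn) => x; rewrite mxE.
Qed.

End PolynomialJets.

Section PolynomialJetSystems.
Variables (k : closedFieldType) (N n l0 m : nat) (f : m.-tuple {mpoly k[N]}).

Lemma polymx_jet_trunc n' l : polymx (fun x : 'rV[k]_(N * n'.+1) => jet_trunc l x).
Proof.
move=> i p; rewrite ord1; case/mxvec_indexP: p => j u.
have ul : (u <= l)%N by rewrite -ltnS.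
have e x : jet_trunc l x 0 (mxvec_index j u) = series_coef x j u :> k.
  have := series_coefE (jet_trunc l x) j u.
  by rewrite ul inord_val series_coef_trunc ul.
case: (leqP u n') => un.
  apply: polyfun_eq (polyfun_coord k (mxvec_index j (inord u : 'I_n'.+1))) => x.
  by rewrite e series_coefE un.
apply: polyfun_eq (polyfun_const _ 0) => x.
by rewrite e series_coefE leqNgt un.
Qed.

Lemma polymx_jet_base : polymx (fun x : 'rV[k]_(N * n.+1) => jet_base l0 x).
Proof.
exact: (polymx_comp (@polymx_jet_trunc l0 n) (@polymx_jet_trunc n l0)).
Qed.

Lemma polymx_jet_mx : polymx (fun x : 'rV[k]_(N * n.+1) => jet_mx l0 f x).
Proof.
apply: polymx_coef_mx => i j s sn.
apply: polyfun_eq (polyseries_jet_eval (tnth f j)^`M(i) polymx_jet_base sn) => x.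
by rewrite !mxE.
Qed.

Lemma polymx_jet_rhs : polymx (fun x : 'rV[k]_(N * n.+1) => jet_rhs l0 f x).
Proof.
apply: polymxD; first exact: polymxM polymx_jet_base polymx_jet_mx.
apply: polymxN; apply: polymx_jet_coord => q s sn.
apply: polyfun_eq (polyseries_jet_eval (tnth f q) polymx_jet_base sn) => x.
by rewrite mxE.
Qed.

End PolynomialJetSystems.

(** * Truncations of the strata and their fibrations *)

Section JetFibrations.
Variables (k : closedFieldType) (N n l0 g b m : nat).
Variables (e : b.-tuple nat) (f : m.-tuple {mpoly k[N]}).
Hypotheses (nl0 : (n < l0.+1 + l0.+1)%N) (l0n : (l0 <= n)%N) (gE : g = (n - l0)%N).
Hypotheses (se : sorted leq e) (eg : all (fun a => a < g)%N e) (bN : (b <= N)%N).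

Local Notation L := (jet_stratum (n := n) g f e).
Local Notation piL l := (trunc_image (l := l) L).
Local Notation A := (@jet_mx k N n l0 m f).
Local Notation w := (@jet_rhs k N n l0 m f).
Local Notation r := (level_rank n e).
Local Notation above c := [set p : 'I_(N * n.+1) | c < jlev p]%N.

Let LP x : L x <-> x *m A x = w x /\
  forall c, (l0 <= c <= n)%N -> \rank (maskmx k (above c) *m A x) = r c.
Proof. exact: jet_stratumP. Qed.

Lemma jet_mx_trunc x y : jet_trunc l0 x = jet_trunc l0 y -> A x = A y.
Proof. by move=> xy; rewrite /jet_mx /jet_base xy. Qed.

Lemma jet_rhs_trunc x y : jet_trunc l0 x = jet_trunc l0 y -> w x = w y.
Proof. by move=> xy; rewrite /jet_rhs (jet_mx_trunc xy) /jet_base xy. Qed.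

#[local] Opaque jet_mx jet_rhs jet_trunc.

Lemma trunc_image_trunc l l' (y : 'rV[k]_(N * l'.+1)) :
  (l <= l')%N -> piL l' y -> piL l (jet_trunc l y).
Proof. by move=> ll [x Lx ->]; exists x => //; rewrite jet_trunc_comp. Qed.

Lemma pad_low l (y : 'rV[k]_(N * l.+1)) (x : 'rV[k]_(N * n.+1)) p :
  (l <= n)%N -> y = jet_trunc l x -> (jlev p <= l)%N -> jet_trunc n y 0 p = x 0 p.
Proof.
move=> ln -> pl; have /jet_trunc_eqP := @jet_trunc_pad k N n l (jet_trunc l x) ln.
exact.
Qed.

Lemma pad_high l (y : 'rV[k]_(N * l.+1)) (p : 'I_(N * n.+1)) :
  (l < jlev p)%N -> jet_trunc n y 0 p = 0.
Proof.
case/mxvec_indexP: p => i u; rewrite jlevE => lu.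
have un : (u <= n)%N by rewrite -ltnS.
have := series_coefE (jet_trunc n y) i u; rewrite un inord_val => <-.
by rewrite series_coef_trunc un series_coefE leqNgt lu.
Qed.

(** The system for the coefficients above level [l], augmented by its right-hand
    side. *)
Definition lift_defect l (y : 'rV[k]_(N * l.+1)) :=
  let x := jet_trunc n y in
  col_mx (maskmx k (above l) *m A x) (w x - x *m A x).

(** A linear system is solvable iff augmenting it by its right-hand side does not
    increase the rank. *)
Lemma trunc_imageP l (y : 'rV[k]_(N * l.+1)) : (l0 <= l <= n)%N ->
  piL l y <->
  (forall c, (l0 <= c <= n)%N ->
     \rank (maskmx k (above c) *m A (jet_trunc n y)) = r c) /\
  (\rank (lift_defect y) <= r l)%N.
Proof.
move=> lln; have /andP[l0l ln] := lln; set x := jet_trunc n y.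
have xl : jet_trunc l x = y by rewrite jet_trunc_pad.
split=> [[x' /LP[xA rk] yE]|[rk dl]].
  have tr : jet_trunc l0 x = jet_trunc l0 x'.
    by rewrite -(jet_trunc_comp x l0l) xl yE jet_trunc_comp.
  rewrite (jet_mx_trunc tr); split=> //; rewrite -(rk l) // /lift_defect -/x.
  rewrite (jet_rhs_trunc tr) (jet_mx_trunc tr) -xA -mulmxBl -addsmxE.
  suff sub : ((x' - x) *m A x' <= maskmx k (above l) *m A x')%MS.
    by rewrite (addsmx_idPl sub).
  suff -> : x' - x = (x' - x) *m maskmx k (above l) by rewrite -mulmxA submxMl.
  apply/rowP => p; rewrite mulmx_maskE inE; case: ltnP => // pl.
  by rewrite !mxE (pad_low ln yE pl) subrr.
have : (w x - x *m A x <= maskmx k (above l) *m A x)%MS.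
  apply: submx_trans (addsmxSr (maskmx k (above l) *m A x) _) _.
  have := mxrank_leqif_eq (addsmxSl (maskmx k (above l) *m A x) (w x - x *m A x)).
  rewrite addsmxE -/(lift_defect y) rk // => -[le]; rewrite eqn_leq le dl.
  by move=> /esym/andP[].
case/submxP => v ev; set x' := x + v *m maskmx k (above l).
have agree p : (jlev p <= l)%N -> x' 0 p = x 0 p.
  by move=> pl; rewrite mxE mulmx_maskE inE ltnNge pl addr0.
have tr : jet_trunc l x' = jet_trunc l x by apply/jet_trunc_eqP.
have tr0 : jet_trunc l0 x' = jet_trunc l0 x.
  by rewrite -(jet_trunc_comp x' l0l) tr jet_trunc_comp.
exists x'; last by rewrite tr xl.
apply/LP; rewrite (jet_mx_trunc tr0) (jet_rhs_trunc tr0); split=> //.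
by rewrite mulmxDl -mulmxA -ev addrC subrK.
Qed.

Lemma locally_closed_trunc_image l : (l0 <= l <= n)%N -> locally_closed (piL l).
Proof.
move=> lln; have /andP[l0l ln] := lln.
have pA c : polymx (fun y : 'rV[k]_(N * l.+1) =>
    maskmx k (above c) *m A (jet_trunc n y)).
  apply: polymxM; first exact: polymx_const.
  exact: (polymx_comp (polymx_jet_mx l0 f) (@polymx_jet_trunc k N l n)).
have pD : polymx (fun y : 'rV[k]_(N * l.+1) => lift_defect y).
  apply: polymx_col_mx => //; apply: polymxD.
    exact: (polymx_comp (polymx_jet_rhs l0 f) (@polymx_jet_trunc k N l n)).
  apply: polymxN; apply: polymxM; first exact: polymx_jet_trunc.
  exact: (polymx_comp (polymx_jet_mx l0 f) (@polymx_jet_trunc k N l n)).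
pose cs := [seq c <- iota 0 n.+1 | l0 <= c]%N.
have csP c : (c \in cs) = (l0 <= c <= n)%N by rewrite mem_filter mem_iota ltnS.
exists (fun y => forall c, c \in cs ->
   r c <= \rank (maskmx k (above c) *m A (jet_trunc n y)))%N.
exists (fun y => forall c, if c is Some c
   then c \in cs -> \rank (maskmx k (above c) *m A (jet_trunc n y)) <= r c
   else \rank (lift_defect y) <= r l)%N; split.
- by apply: zopen_forall_seq => c; exact: zopen_rank_ge.
- apply: zclosed_forall => -[c|]; last exact: zclosed_rank_le.
  have [cc|nc] := boolP (c \in cs).
    by apply: zclosed_iff (zclosed_rank_le (r c) (pA c)) => y; split=> [|/(_ isT)].
  by exists (fun=> False) => y; split=> [_ p []|_].
move=> y; rewrite trunc_imageP //; split=> [[rk dl]|[ge le]].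
  by split=> [c|[c|]] //; rewrite ?csP => cc; rewrite rk.
split=> [c cc|]; last exact: (le None).
by apply/eqP; rewrite eqn_leq (ge c) ?(le (Some c)) ?csP.
Qed.

(** The number of unknowns of level above [c] that are not pivots. *)
Definition free_dim c := (N * (n - c) - r c)%N.

Section Chart.
Variables (P : {set 'I_(N * n.+1)}) (C : 'M[k]_(m * n.+1, N * n.+1)).
Hypothesis Pl0 : forall p, p \in P -> (l0 < jlev p)%N.
Hypothesis cardP : forall c, (l0 <= c <= n)%N ->
  #|[set p in P | c < jlev p]%N| = r c.

Local Notation K x := (pivot_mx P C (A x)).
Local Notation F := (maskmx k (~: P)).

(** The open set on which the pivot rows chosen at one point stay independent;
    since the ranks are constant on the stratum, they remain bases for all
    levels there ([chart_rank]). *)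
Definition chart_base (y : 'rV[k]_(N * l0.+1)) :=
  piL l0 y /\ K (jet_trunc n y) \in unitmx.

Definition chart l (y : 'rV[k]_(N * l.+1)) :=
  piL l y /\ chart_base (jet_trunc l0 y).

Lemma chartP l (y : 'rV[k]_(N * l.+1)) : (l0 <= l <= n)%N ->
  chart y <-> exists x, [/\ L x, K x \in unitmx & y = jet_trunc l x].
Proof.
case/andP=> l0l ln.
have pad (x : 'rV[k]_(N * n.+1)) : y = jet_trunc l x ->
    jet_trunc l0 (jet_trunc n (jet_trunc l0 y)) = jet_trunc l0 x.
  by move=> yE; rewrite (jet_trunc_pad _ l0n) yE jet_trunc_comp.
split=> [[[x Lx yE] [_ uK]]|[x [Lx uK yE]]].
  by exists x; rewrite -(jet_mx_trunc (pad x yE)); split.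
split; first by exists x.
split; first by exists x => //; rewrite yE jet_trunc_comp.
by rewrite (jet_mx_trunc (pad x yE)).
Qed.

Lemma chart_rank x : L x -> forall c, (l0 <= c)%N ->
  \rank (maskmx k (above c) *m A x) = #|[set p in P | c < jlev p]%N|.
Proof.
move=> /LP[_ rk] c lc; have [cn|nc] := leqP c n; first by rewrite rk ?cardP ?lc.
have big0 (B : {set 'I_(N * n.+1)}) : B \subset above c -> #|B| = 0%N.
  move=> Bc; apply/eqP; rewrite cards_eq0 -subset0; apply/subsetP => p /(subsetP Bc).
  by rewrite !inE ltnNge (leq_trans _ nc) ?ltn_ord // ltnW.
rewrite big0; last by apply/subsetP => p; rewrite !inE => /andP[].
by apply/eqP; rewrite -leqn0 (leq_trans (rank_mask_le _ _)) // big0.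
Qed.

Definition complete z := solve_pivots P C (A z) (w z) z.

Lemma complete_free z p : p \notin P -> complete z 0 p = z 0 p.
Proof.
move=> pP.
have := congr1 (fun v : 'rV[k]_(N * n.+1) => v 0 p)
  (solve_pivots_free P C (A z) (w z) z).
by rewrite /= !mulmx_maskE inE pP.
Qed.

Lemma complete_stratum l (x z : 'rV[k]_(N * n.+1)) : (l0 <= l)%N -> L x -> K x \in unitmx ->
    (forall p, (jlev p <= l)%N -> z 0 p = x 0 p) ->
  [/\ L (complete z), K (complete z) \in unitmx
    & forall p, (jlev p <= l)%N -> complete z 0 p = x 0 p].
Proof.
move=> l0l Lx uK zx; have [xA rk] := iffLR (LP x) Lx.
have trz : jet_trunc l0 z = jet_trunc l0 x.
  by apply/jet_trunc_eqP => p pl; rewrite zx // (leq_trans pl).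
have [] := solve_pivots_level uK (chart_rank Lx) l0l xA zx.
rewrite /complete (jet_mx_trunc trz) (jet_rhs_trunc trz).
set y := solve_pivots _ _ _ _ _ => yA yx.
have try : jet_trunc l0 y = jet_trunc l0 x.
  by apply/jet_trunc_eqP => p pl; rewrite yx // (leq_trans pl).
split; [|by rewrite (jet_mx_trunc try)|exact: yx].
by apply/LP; rewrite (jet_mx_trunc try) (jet_rhs_trunc try).
Qed.

Lemma stratum_free_eq l (x y : 'rV[k]_(N * n.+1)) : (l0 <= l)%N -> L x -> L y -> K x \in unitmx ->
    (forall p, (jlev p <= l)%N -> p \notin P -> x 0 p = y 0 p) ->
  jet_trunc l x = jet_trunc l y.
Proof.
move=> l0l Lx Ly uK xy; have [xA _] := iffLR (LP x) Lx; have [yA _] := iffLR (LP y) Ly.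
have tr : jet_trunc l0 y = jet_trunc l0 x.
  apply/jet_trunc_eqP => p pl; rewrite xy // ?(leq_trans pl) //.
  by apply/negP => /Pl0; rewrite ltnNge pl.
rewrite (jet_mx_trunc tr) (jet_rhs_trunc tr) in yA.
by apply/jet_trunc_eqP; exact: (solution_eq_level uK (chart_rank Lx) l0l xA yA xy).
Qed.

Section Fibration.
Variables l l' : nat.
Hypotheses (l0l : (l0 <= l)%N) (ll' : (l <= l')%N) (l'n : (l' <= n)%N).

Let ln : (l <= n)%N := leq_trans ll' l'n.
Let l0l' : (l0 <= l')%N := leq_trans l0l ll'.

Definition fiber_coords := [set p : 'I_(N * n.+1) | p \notin P & l < jlev p <= l']%N.
Local Notation Fr := fiber_coords.

Definition insert_mx : 'M[k]_(#|Fr|, N * n.+1) :=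
  \matrix_(j, p) (enum_val j == p)%:R.

Lemma mul_insert_tr q (v : 'M[k]_(q, N * n.+1)) i j :
  (v *m insert_mx^T) i j = v i (enum_val j).
Proof.
rewrite mxE (bigD1 (enum_val j)) //= !mxE eqxx mulr1 big1 ?addr0 // => p pj.
by rewrite !mxE eq_sym (negPf pj) mulr0.
Qed.

Lemma mul_insert_notin q (s : 'M[k]_(q, #|Fr|)) i p :
  p \notin Fr -> (s *m insert_mx) i p = 0.
Proof.
move=> pF; rewrite mxE big1 // => j _; rewrite mxE.
by case: eqP => [ep|]; rewrite ?mulr0 //; case/negP: pF; rewrite -ep enum_valP.
Qed.

Lemma mul_insert_val q (s : 'M[k]_(q, #|Fr|)) i j :
  (s *m insert_mx) i (enum_val j) = s i j.
Proof.
rewrite mxE (bigD1 j) //= mxE eqxx mulr1 big1 ?addr0 // => j' jj'.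
by rewrite mxE (inj_eq enum_val_inj) (negPf jj') mulr0.
Qed.

Definition chart_input (t : 'rV[k]_(N * l.+1 + #|Fr|)) : 'rV[k]_(N * n.+1) :=
  jet_trunc n (lsubmx t) + rsubmx t *m insert_mx.

Lemma chart_input_low t (x : 'rV[k]_(N * n.+1)) p : lsubmx t = jet_trunc l x -> (jlev p <= l)%N ->
  chart_input t 0 p = x 0 p.
Proof.
move=> tx pl; rewrite mxE (pad_low ln tx pl) mul_insert_notin ?addr0 //.
by rewrite inE ltnNge pl andbF.
Qed.

Lemma chart_input_fiber t j : chart_input t 0 (enum_val j) = rsubmx t 0 j.
Proof.
rewrite mxE mul_insert_val pad_high ?add0r //.
by have := enum_valP j; rewrite inE => /and3P[].
Qed.

Definition chart_fwd (x : 'rV[k]_(N * l'.+1)) : 'rV[k]_(N * l.+1 + #|Fr|) :=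
  row_mx (jet_trunc l x) (jet_trunc n x *m insert_mx^T).

Definition chart_bwd (t : 'rV[k]_(N * l.+1 + #|Fr|)) : 'rV[k]_(N * l'.+1) :=
  jet_trunc l' (complete (chart_input t)).

Lemma jet_truncZ n1 n2 (a : k) (x : 'rV[k]_(N * n1.+1)) :
  jet_trunc n2 (a *: x) = a *: jet_trunc n2 x.
Proof.
apply: series_coef_inj => i s s2.
have cZ n3 (z : 'rV[k]_(N * n3.+1)) : series_coef (a *: z) i s = a * series_coef z i s.
  by rewrite !series_coefE; case: ifP; rewrite ?mulr0 // mxE.
by rewrite cZ !series_coef_trunc cZ; case: ifP; rewrite ?mulr0.
Qed.

(** The trivialization records the truncation together with the free coefficients
    of level between [l] and [l']. Its inverse inserts the latter into the
    truncation, sets all higher free coefficients to zero, solves for the pivots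
    and truncates the result. Neither the values at the pivots of the inserted
    vector nor the choice of the higher free coefficients affect the outcome
    ([stratum_free_eq]). *)
Lemma chart_fibration : trivial_fibration (chart (l := l')) (chart (l := l))
  (jet_trunc l (n := l')) (affine_space k #|Fr|).
Proof.
have l0ln : (l0 <= l <= n)%N by rewrite l0l.
have l0l'n : (l0 <= l' <= n)%N by rewrite l0l'.
exists chart_fwd, chart_bwd; split; last by move=> x _; rewrite row_mxKl.
have input t : chart (lsubmx t) -> exists x, [/\ L x, K x \in unitmx,
    lsubmx t = jet_trunc l x & A (chart_input t) = A x].
  move=> /(chartP _ l0ln)[x [Lx uK tx]]; exists x; split; [exact: Lx|exact: uK|exact: tx|].
  apply: jet_mx_trunc; apply/jet_trunc_eqP => p pl.
  by rewrite (chart_input_low tx) // (leq_trans pl).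
have pin : polymx chart_input.
  apply: polymxD; first exact: polymx_comp (@polymx_jet_trunc k N l n) (@polymx_lsubmx k _ _).
  by apply: polymxM; [exact: polymx_rsubmx | exact: polymx_const].
split.
- apply: regular_polymx; apply: polymx_row_mx; first exact: polymx_jet_trunc.
  by apply: polymxM; [exact: polymx_jet_trunc | exact: polymx_const].
- have pA := polymx_comp (polymx_jet_mx l0 f) pin.
  have pw := polymx_comp (polymx_jet_rhs l0 f) pin.
  have pK : polymx (fun t => K (chart_input t)).
    apply: polymxD; last exact: polymx_const.
    exact: polymxM (polymxM (polymx_const _ _) pA) (polymx_const _ _).
  pose zF t := chart_input t *m F.
  have pzF : polymx zF by exact: polymxM pin (polymx_const _ _).
  pose num t := \det (K (chart_input t)) *: zF t
    + (w (chart_input t) - zF t *m A (chart_input t)) *m C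
      *m \adj (K (chart_input t)) *m maskmx k P.
  have pnum : polymx num.
    apply: polymxD; first exact: polymxZ (polymx_det pK) pzF.
    apply: polymxM (polymx_const _ _); apply: polymxM (polymx_adj pK).
    apply: polymxM (polymx_const _ _); apply: polymxD pw _.
    exact: polymxN (polymxM pzF pA).
  apply: (regular_frac (polymx_det pK) (polymx_comp (@polymx_jet_trunc k N n l') pnum)).
    move=> t [/input[x [_ uK _ ->]] _].
    by rewrite -unitfE -unitmxE.
  move=> t [/input[x [_ uK _ eA]] _].
  rewrite -jet_truncZ; congr jet_trunc; rewrite scalerDr scalerA.
  rewrite -eA unitmxE unitfE in uK.
  rewrite (mulVf uK) scale1r /complete /solve_pivots; congr (_ + _).
  rewrite /invmx unitmxE unitfE uK -/(zF t).
  by rewrite -scalemxAr -scalemxAl.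
- move=> y /(chartP _ l0l'n)[x [Lx uK yx]].
  have tl : lsubmx (chart_fwd y) = jet_trunc l x by rewrite row_mxKl yx jet_trunc_comp.
  split.
    rewrite /zproduct; split; last by [].
    rewrite tl; apply: (iffRL (chartP _ l0ln)).
    by exists x; split; [exact: Lx|exact: uK|].
  have [Lh uKh hx] := complete_stratum l0l Lx uK (fun p => chart_input_low (p := p) tl).
  rewrite [RHS]yx /chart_bwd; apply: (stratum_free_eq l0l' Lh Lx uKh) => p pl' pP.
  have [pl|lp] := leqP (jlev p) l; first by rewrite hx.
  have pF : p \in Fr by rewrite inE pP lp.
  rewrite complete_free // -(enum_rankK_in pF pF) chart_input_fiber row_mxKr.
  by rewrite mul_insert_tr (pad_low l'n yx) // enum_rankK_in.
- move=> t [ct _]; have [x [Lx uK tx _]] := input t ct.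
  have [Lh uKh hx] := complete_stratum l0l Lx uK (fun p => chart_input_low (p := p) tx).
  split.
    apply: (iffRL (chartP _ l0l'n)).
    by exists (complete (chart_input t)); split; [exact: Lh|exact: uKh|].
  rewrite -[RHS]hsubmxK; congr row_mx.
    by rewrite jet_trunc_comp // tx; apply/jet_trunc_eqP.
  apply/rowP => j; rewrite mul_insert_tr -chart_input_fiber.
  have := enum_valP j; rewrite inE => /and3P[pP _ pl'].
  by rewrite (pad_low l'n (erefl (chart_bwd t))) // complete_free.
Qed.

Lemma card_fiber_coords : #|Fr| = (free_dim l - free_dim l')%N.
Proof.
have card_above c : #|above c| = (N * (n - c))%N.
  rewrite (card_levels n (fun _ : 'I_N => c.+1)) sum_nat_const card_ord.
  by rewrite subSS.
have card_free c : (l0 <= c <= n)%N -> #|[set p | p \notin P & c < jlev p]%N| = free_dim c.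
  move=> cc; rewrite /free_dim -cardP // -card_above -(cardsID P (above c)).
  rewrite [X in (X + _)%N](_ : _ = #|[set p in P | c < jlev p]%N|); last first.
    by congr #|pred_of_set _|; apply/setP => p; rewrite !inE andbC.
  rewrite addKn; congr #|pred_of_set _|; apply/setP => p.
  by rewrite !inE.
have l0ln : (l0 <= l <= n)%N by rewrite l0l.
have l0l'n : (l0 <= l' <= n)%N by rewrite l0l'.
rewrite -!card_free // -(cardsID (above l') [set p | p \notin P & l < jlev p]%N).
rewrite [X in (X + _ - _)%N](_ : _ = #|[set p | p \notin P & l' < jlev p]%N|).
  rewrite addKn; congr #|pred_of_set _|; apply/setP => p; rewrite !inE.
  by rewrite -leqNgt; case: (p \in P); case: (l < _)%N; case: (_ <= l')%N.
congr #|pred_of_set _|; apply/setP => p; rewrite !inE -andbA; congr (_ && _).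
by apply: andb_idl => l'p; rewrite (leq_ltn_trans ll').
Qed.

End Fibration.
End Chart.

Lemma chart_exists gamma : piL l0 gamma ->
  exists (P : {set 'I_(N * n.+1)}) (C : 'M[k]_(m * n.+1, N * n.+1)),
  [/\ forall p, p \in P -> (l0 < jlev p)%N,
      forall c, (l0 <= c <= n)%N -> #|[set p in P | c < jlev p]%N| = r c
    & chart_base P C gamma].
Proof.
move=> g_in; have [x Lx gx] := g_in.
have tr : jet_trunc l0 (jet_trunc n gamma) = jet_trunc l0 x by rewrite jet_trunc_pad.
have levn (p : 'I_(N * n.+1)) : (jlev p <= n)%N by rewrite -ltnS.
have [P [Pl0 iP rP]] := level_pivots (A x) l0 levn.
have [C eC] := pivot_mx_exists iP; exists P, C; split=> // [c cc|].
  have [_ rk] := iffLR (LP x) Lx; rewrite -rk // rP //.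
  by case/andP: cc.
by split=> //; rewrite (jet_mx_trunc tr) eC unitmx1.
Qed.

End JetFibrations.

(** * Fibre dimensions and the comparison of two schemes *)

Lemma max_nth_lt (s : seq nat) j : sorted leq s -> (0 < j)%N ->
  \max_(i < (size s).+1 | (nth 0 (0 :: s) i < j)%N) i
    = count (fun y => y < j)%N s.
Proof.
move=> ss j0; have s0 : sorted leq (0%N :: s) by case: (s) ss.
have ltE (i : 'I_(size s).+1) :
    (nth 0 (0 :: s) i < j)%N = (i <= count (fun y => y < j)%N s)%N.
  by rewrite sorted_nth_lt //= j0 add1n ltnS.
apply/eqP; rewrite eqn_leq; apply/andP; split.
  by apply/bigmax_leqP => i; rewrite ltE.
have cs : (count (fun y => y < j)%N s < (size s).+1)%N by rewrite ltnS count_size.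
by apply: (@leq_bigmax_cond _ _ (fun i => val i) (Ordinal cs)); rewrite ltE.
Qed.

Lemma trivial_fibration_iff (k : closedFieldType) d r q (S S' : 'rV[k]_d -> Prop)
    (T : 'rV[k]_r -> Prop) h (F : 'rV[k]_q -> Prop) :
  (forall x, S x <-> S' x) ->
  trivial_fibration S T h F -> trivial_fibration S' T h F.
Proof.
move=> SS' [phi [psi [[rphi rpsi psiK phiK] hphi]]]; exists phi, psi; split.
  split=> // [x /SS' Sx j|x /SS'|y /phiK[/SS' ? ?]] //; last exact: psiK.
  have [P [Q [Q0 eQ]]] := rphi x Sx j; exists P, Q; split=> // y /SS'; exact: eQ.
by move=> x /SS'; exact: hphi.
Qed.

(** By the Leibniz rule, because the generators vanish at the jet. *)
Lemma jet_mx_in_ideal (k : closedFieldType) (N n m s : nat)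
    (f : m.-tuple {mpoly k[N]}) (h : s.-tuple {mpoly k[N]})
    (x : 'rV[k]_(N * n.+1)) :
    jets f x -> (forall i, in_ideal f (tnth h i)) ->
  exists U, jet_jacobian h x = U *m jet_jacobian f x.
Proof.
move=> fx hf; have [c hc] := fin_all_exists hf.
exists (\matrix_(i, q) jet_eval (c i q) x); apply/matrixP => i j.
have evM p q : jet_eval (p * q) x = jet_eval p x * jet_eval q x by exact: rmorphM.
have evD p q : jet_eval (p + q) x = jet_eval p x + jet_eval q x by exact: mmapD.
have f0 q : jet_eval (tnth f q) x = 0.
  apply: fx; exists (fun q' => (q' == q)%:R).
  rewrite (bigD1 q) //= eqxx mul1r big1 ?addr0 // => q' /negPf ->.
  by rewrite mul0r.
rewrite !mxE hc raddf_sum [LHS]raddf_sum /=; apply: eq_bigr => q _.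
rewrite [X in _ = X * _]mxE [X in _ = _ * X]mxE.
rewrite -[LHS]/(jet_eval ((c i q * tnth f q)^`M(j)) x) mderivM evD !evM f0.
by rewrite mulr0 add0r.
Qed.

Section Consequences.
Variables (k : closedFieldType) (N n l0 g b m : nat).
Variables (e : b.-tuple nat) (f : m.-tuple {mpoly k[N]}).
Hypotheses (nl0 : (n < l0.+1 + l0.+1)%N) (l0n : (l0 <= n)%N) (gE : g = (n - l0)%N).
Hypotheses (se : sorted leq e) (eg : all (fun a => a < g)%N e) (bN : (b <= N)%N).

(** The rows of the Jacobian matrix of [h] are combinations of those of [f], so the
    kernel of the system of [f] lies in the kernel of the system of [h]; both
    have the same rank, hence the kernels are equal. The difference of the two
    jets lies in the kernel for [h]. *)
Lemma jet_stratum_sub_ideal (s : nat) (h : s.-tuple {mpoly k[N]})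
    (theta alpha : 'rV[k]_(N * n.+1)) :
    jet_stratum g f e theta -> (forall i, in_ideal f (tnth h i)) ->
    jet_stratum g h e theta -> jet_stratum g h e alpha ->
    jet_trunc l0 alpha = jet_trunc l0 theta ->
  jet_stratum g f e alpha.
Proof.
move=> ft hf ht ha tr; pose M := maskmx k [set p : 'I_(N * n.+1) | l0 < jlev p]%N.
have [U eU] := jet_mx_in_ideal ft.1 hf.
have stratumP s' (f' : s'.-tuple {mpoly k[N]}) x :=
  @jet_stratumP k N n l0 g b s' e f' nl0 l0n gE se eg bN x.
have [tA trk] := iffLR (stratumP _ _ _) ft.
have [htA htrk] := iffLR (stratumP _ _ _) ht.
have [haA _] := iffLR (stratumP _ _ _) ha.
apply: (iffRL (stratumP _ _ _)); rewrite (jet_mx_trunc f tr) (jet_rhs_trunc f tr).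
rewrite (jet_mx_trunc h tr) (jet_rhs_trunc h tr) in haA.
split; last exact: trk.
have l0c : (l0 <= l0 <= n)%N by rewrite leqnn.
have eM : M *m jet_mx l0 h theta = M *m jet_mx l0 f theta *m coef_mx U^T.
  rewrite [LHS](jet_mx_base nl0 h theta (leqnn l0)) eU trmx_mul coef_mxM.
  have ef := jet_mx_base nl0 f theta (leqnn l0).
  exact: etrans (mulmxA _ _ _) (congr1 (fun Z => Z *m coef_mx U^T) (esym ef)).
have subK : (kermx (M *m jet_mx l0 f theta) <= kermx (M *m jet_mx l0 h theta))%MS.
  by apply/sub_kermxP; rewrite eM mulmxA mulmx_ker mul0mx.
have := mxrank_leqif_eq subK; rewrite !mxrank_ker trk // htrk // => -[_].
rewrite eqxx => /esym/andP[_ supK].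
have dM : alpha - theta = (alpha - theta) *m M.
  apply/rowP => p; rewrite mulmx_maskE inE; case: ltnP => // pl.
  by rewrite !mxE (iffLR (jet_trunc_eqP _ _ _) tr) ?subrr.
have : ((alpha - theta) <= kermx (M *m jet_mx l0 h theta))%MS.
  by apply/sub_kermxP; rewrite mulmxA -dM mulmxBl haA htA subrr.
move=> /submx_trans/(_ supK)/sub_kermxP; rewrite mulmxA -dM mulmxBl tA.
by move/eqP; rewrite subr_eq0 => /eqP.
Qed.

Local Notation L := (jet_stratum (n := n) g f e).
Local Notation piL l := (trunc_image (l := l) L).
Local Notation r := (level_rank n e).
Local Notation fd := (free_dim N n e).

Lemma chart_base_open (P : {set 'I_(N * n.+1)}) (C : 'M[k]_(m * n.+1, N * n.+1)) l :
  zopen (fun y : 'rV[k]_(N * l.+1) =>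
    pivot_mx P C (jet_mx l0 f (jet_trunc n (jet_trunc l0 y))) \in unitmx).
Proof.
pose phi (y : 'rV[k]_(N * l.+1)) :=
  \det (pivot_mx P C (jet_mx l0 f (jet_trunc n (jet_trunc l0 y)))).
have pphi : polyfun phi.
  apply: polymx_det; apply: polymxD (polymx_const _ _).
  apply: polymxM (polymx_const _ _); apply: polymxM (polymx_const _ _) _.
  apply: (polymx_comp (polymx_jet_mx l0 f)).
  exact: (polymx_comp (@polymx_jet_trunc k N l0 n) (@polymx_jet_trunc k N l l0)).
apply: zclosed_iff (zopen_polyfun_neq0 pphi) => y.
by rewrite unitmxE unitfE.
Qed.

Lemma level_rank_le l : (r l <= N * (n - l))%N.
Proof.
rewrite (leq_trans _ (leq_mul bN (leqnn _))) // /level_rank.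
rewrite (@leq_trans (\sum_(y <- e) (n - l))%N) ?leq_sum // => [y _|].
  by rewrite leq_subr.
by rewrite big_const_seq count_predT size_tuple iter_addn_0 mulnC.
Qed.

(** The maximum is the number of invariants below [n - l], by which the ranks at
    [l] and at [l + 1] differ. *)
Lemma free_dimS l : (l < n)%N ->
  (fd l - fd l.+1 = N - \max_(i < b.+1 | (nth 0 (0 :: e) i < n - l)%N) i)%N.
Proof.
move=> ln; set a := \max_(i < _ | _) _.
have ea : a = count (fun y => y < n - l)%N e.
  have := @max_nth_lt e (n - l) se; rewrite subn_gt0 ln => <- //.
  by rewrite /a; move: (size_tuple e) => ->.
have nl : (n - l = (n - l.+1).+1)%N by rewrite -subSn // subSS.
have rS : r l = (r l.+1 + a)%N by rewrite /level_rank nl sum_subn_count ea nl.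
rewrite /free_dim nl mulnS rS; have := level_rank_le l.+1.
move: (N * _)%N (r _) => X Y YX.
by rewrite -[X in (N + X)%N](subnK YX) addnA subnDA addnK subnAC addnK.
Qed.

Lemma free_dim_n : fd n = 0%N.
Proof. by rewrite /free_dim subnn muln0. Qed.

Lemma free_dim_base : fd l0 = ((N - b) * g + \sum_(y <- e) y)%N.
Proof.
have E : (\sum_(y <- e) (g - y) + \sum_(y <- e) y = b * g)%N.
  rewrite -big_split /= (@eq_big_seq _ _ _ _ _ _ (fun=> g)) => [|y ye] /=.
    by rewrite big_const_seq count_predT size_tuple iter_addn_0 mulnC.
  by rewrite subnK // ltnW //; move/allP: eg; apply.
rewrite /free_dim /level_rank -gE -(subnK bN) mulnDl -E subnK //.
by rewrite addnA addnAC addnK.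
Qed.

Lemma trunc_chain_fibration l l' (P : {set 'I_(N * n.+1)})
    (C : 'M[k]_(m * n.+1, N * n.+1)) :
    (l0 <= l)%N -> (l <= l')%N -> (l' <= n)%N ->
    (forall p, p \in P -> (l0 < jlev p)%N) ->
    (forall c, (l0 <= c <= n)%N -> #|[set p in P | c < jlev p]%N| = r c) ->
  trivial_fibration (chart l0 g e f P C (l := l')) (chart l0 g e f P C (l := l))
    (jet_trunc l (n := l')) (affine_space k (fd l - fd l')).
Proof.
move=> l0l ll' l'n Pl0 cardP.
rewrite -(card_fiber_coords cardP l0l ll' l'n).
exact: (chart_fibration f nl0 l0n gE se eg bN C Pl0 cardP l0l ll' l'n).
Qed.

End Consequences.

(** * The structure of the truncation maps *)

Theorem proposition3 (k : closedFieldType) (N m n g b : nat)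
    (f : m.-tuple {mpoly k[N]}) (e : b.-tuple nat)
    (hg : g = if odd n then n.+1./2 else n./2)
    (he_sorted : sorted leq e) (he_lt : all (fun a => (a < g)%N) e)
    (hbm : (b <= m)%N) (hbN : (b <= N)%N) :
  let L := jet_stratum (n := n) g f e in
  let piL l := trunc_image (l := l) L in
  [/\ (* (a) *)
      forall l, (n - g <= l <= n)%N -> locally_closed (piL l),
      (* (b) *)
      forall gamma, piL (n - g)%N gamma ->
        exists U : 'rV[k]_(N * (n - g).+1) -> Prop,
          [/\ open_in (piL (n - g)%N) U, U gamma
            & let Ui i := fun x : 'rV[k]_(N * i.+1) =>
                piL i x /\ U (jet_trunc (n - g) x) in
              forall l, (n - g <= l < n)%N ->
              let a := (\max_(i < b.+1 | nth 0 (0 :: e) i < n - l) i)%N in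
              trivial_fibration (Ui l.+1) (Ui l) (jet_trunc l (n := l.+1))
                (affine_space k (N - a))],
      (* (c) *)
      forall l, (n - g <= l < n)%N ->
        exists d,
          [/\ locally_trivial_fibration L (piL l) (jet_trunc l (n := n))
                (affine_space k d),
              l = (n - g)%N -> (uphalf ((N - b) * n) <= d)%N
            & l = (n - g)%N -> (n <= 2 * \sum_(x <- e) x)%N ->
                (uphalf ((N - b + 1) * n) <= d)%N]
    & (* (d) *)
      forall (theta : 'rV[k]_(N * n.+1)) (h : b.-tuple {mpoly k[N]}),
        L theta -> (forall i, in_ideal f (tnth h i)) ->
        jet_stratum g h e theta ->
        forall alpha : 'rV[k]_(N * n.+1), jet_stratum g h e alpha ->
          jet_trunc (n - g) alpha = jet_trunc (n - g) theta -> L alpha].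
Proof.
move=> L piL.
have [n2g gn nl0] : [/\ (n <= 2 * g)%N, (g <= n)%N
    & (n < (n - g).+1 + (n - g).+1)%N].
  by rewrite hg; case: ifP => on; split; lia.
have l0n : (n - g <= n)%N by rewrite leq_subr.
have gE : g = (n - (n - g))%N by rewrite subKn.
split.
- move=> l ll.
  exact: (locally_closed_trunc_image f nl0 l0n gE he_sorted he_lt hbN ll).
- move=> gamma gin.
  have [P [C [Pl0 cardP cgamma]]] := chart_exists nl0 l0n gE he_sorted he_lt hbN gin.
  exists (chart_base g e f P C); split; [|exact: cgamma|].
    exists (fun y : 'rV[k]_(_ * _.+1) =>
        pivot_mx P C (jet_mx (n - g) f (jet_trunc n (jet_trunc (n - g) y))) \in unitmx).
      exact: chart_base_open.
    by move=> y; rewrite jet_trunc_id.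
  move=> Ui l /andP[l0l ln] a.
  rewrite -(free_dimS he_sorted hbN ln).
  exact: (trunc_chain_fibration f nl0 l0n gE he_sorted he_lt hbN C l0l
    (leqnSn l) ln Pl0 cardP).
- move=> l /andP[l0l ln]; exists (free_dim N n e l - free_dim N n e n)%N; split.
  + split=> [x Lx|y yin]; first by exists x.
    have gin : piL (n - g)%N (jet_trunc (n - g) y) := trunc_image_trunc l0l yin.
    have [P [C [Pl0 cardP cy]]] := chart_exists nl0 l0n gE he_sorted he_lt hbN gin.
    exists (chart (n - g) g e f P C (l := l)); split.
    * exists (fun y : 'rV[k]_(_ * _.+1) =>
          pivot_mx P C (jet_mx (n - g) f (jet_trunc n (jet_trunc (n - g) y))) \in unitmx).
        exact: chart_base_open.
      move=> z; split=> [[zin [_ uK]]|[zin uK]]; first by split.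
      by split; [|split; [exact: trunc_image_trunc l0l zin|]].
    * by split.
    * have := trunc_chain_fibration f nl0 l0n gE he_sorted he_lt hbN C l0l
        (ltnW ln) (leqnn n) Pl0 cardP.
      apply: trivial_fibration_iff => x.
      split=> [[[x' Lx' ->] cx]|[Lx [_ cx]]].
        rewrite jet_trunc_id in cx *; split; first exact: Lx'.
        by split; [exists x' | rewrite jet_trunc_comp].
      split; first by exists x; rewrite ?jet_trunc_id.
      by rewrite jet_trunc_comp in cx.
  + move=> ->; rewrite free_dim_n subn0 (free_dim_base gE he_lt hbN) leq_uphalf_double.
    by rewrite -mul2n mulnDr mulnCA (leq_trans (leq_mul (leqnn _) n2g)) ?leq_addr.
  + move=> -> sume; rewrite free_dim_n subn0 (free_dim_base gE he_lt hbN) leq_uphalf_double.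
    by rewrite -mul2n mulnDr mulnCA mulnDl mul1n leq_add ?leq_mul.
- move=> theta h Lt hf ht alpha ha tr.
  exact: (jet_stratum_sub_ideal nl0 l0n gE he_sorted he_lt hbN Lt hf ht ha tr).
Qed.
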